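(* For every positive integer $k$ there exists a graph of girth at least $k$ that is (isomorphic to) an induced subgraph of some hypercube $Q_n$ but is not layered.
   Context: The $n$-dimensional hypercube $Q_n$ is the graph with vertex set $\{0,1\}^n$ in which two vertices are adjacent if and only if they differ in exactly one coordinate. The $k$-th layer of $Q_n$ is the subgraph of $Q_n$ induced by all vertices containing exactly $k$ or $k+1$ ones in their coordinate representation. A graph $G$ is layered if there exist some $n$ and $k$ such that $G$ is (isomorphic to) a subgraph, not necessarily induced, of the $k$-th layer of $Q_n$. The girth of a graph is the length of its shortest cycle. *)

(* Defs.v *)
From HB Require Import structures.
From mathcomp Require Import all_boot.

Set Implicit Arguments.
Unset Strict Implicit.
Unset Printing Implicit Defensive.

Record sgraph := SGraph {
  vertex :> finType;
  adj : rel vertex;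
  adj_sym : symmetric adj;
  adj_irrefl : irreflexive adj }.

Section Induced.
Variables (G : sgraph) (S : {set G}).

Definition induced_adj : rel {x : G | x \in S} :=
  fun x y => adj (val x) (val y).

Lemma induced_adj_sym : symmetric induced_adj.
Proof. by move=> x y; apply: adj_sym. Qed.

Lemma induced_adj_irrefl : irreflexive induced_adj.
Proof. by move=> x; apply: adj_irrefl. Qed.

Definition induced : sgraph := SGraph induced_adj_sym induced_adj_irrefl.
End Induced.

(* G is isomorphic to a (not necessarily induced) subgraph of H. *)
Definition embeds (G H : sgraph) : Prop :=
  exists2 f : G -> H, injective f & forall x y, adj x y -> adj (f x) (f y).

(* G is isomorphic to an induced subgraph of H. *)
Definition induced_embeds (G H : sgraph) : Prop :=
  exists2 f : G -> H, injective f & forall x y, adj x y = adj (f x) (f y).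

Section Hypercube.
Variable n : nat.

Definition hc_adj : rel {ffun 'I_n -> bool} :=
  fun x y => #|[set i | x i != y i]| == 1.

Lemma hc_adj_sym : symmetric hc_adj.
Proof.
move=> x y; rewrite /hc_adj; congr (_ == 1); apply: eq_card => i.
by rewrite !inE eq_sym.
Qed.

Lemma hc_adj_irrefl : irreflexive hc_adj.
Proof.
move=> x; rewrite /hc_adj (_ : [set i | _] = set0) ?cards0 //.
by apply/setP => i; rewrite !inE eqxx.
Qed.

Definition hypercube : sgraph := SGraph hc_adj_sym hc_adj_irrefl.

Definition num_ones (x : hypercube) : nat :=
  #|[set i | (x : {ffun 'I_n -> bool}) i]|.

Definition layer (k : nat) : sgraph :=
  induced [set x : hypercube | (num_ones x == k) || (num_ones x == k.+1)].
End Hypercube.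

Definition layered (G : sgraph) : Prop :=
  exists n k : nat, embeds G (layer n k).

(* [ucycleb] alone also accepts the empty sequence and, on two adjacent
   vertices, the back-and-forth walk; a graph cycle has length at least 3. *)
Definition has_cycle (G : sgraph) (l : nat) : bool :=
  (2 < l) && [exists c : l.-tuple G, ucycleb (@adj G) c].

(* The length of a shortest cycle, or [None] (infinite girth) if G is acyclic;
   no cycle is longer than the number of vertices. *)
Definition girth (G : sgraph) : option nat :=
  ohead [seq l <- iota 0 #|G|.+1 | has_cycle G l].

Definition girth_at_least (G : sgraph) (k : nat) : Prop :=
  if girth G is Some g then k <= g else True.

(* Main.v *)
Require Import Defs.
From HB Require Import structures.
From mathcomp Require Import all_boot.
From mathcomp Require Import ssralg zify.

Set Implicit Arguments.
Unset Strict Implicit.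
Unset Printing Implicit Defensive.
Import GRing.Theory.

(** The graph is the mod 2 homology cover of a well chosen finite graph.  Its
    vertices are the pairs of a vertex [x] of that graph and of a set [z] of
    edges, and crossing an edge moves [x] and toggles the edge in [z].  The
    cover of any graph is an induced subgraph of a hypercube whose coordinates
    are essentially the edges ([cover_induced]), and a cycle of the cover
    projects to a closed walk without backtracking, so that the cover inherits a
    lower bound on the girth ([cover_girth]).  It remains to find a graph of
    large girth whose cover is not layered.

    An embedding of the cover into a layer colours its edges by the coordinate
    that changes.  Edges at one vertex have distinct colours, each colour class
    is a cut, and in a layer all edges of one colour are directed from the lower
    to the upper level.  Suppose that an edge [b v] lies on many even closed
    walks, which branch so much that the colours met on a random one are all
    distinct and differ from any few given colours.  Going around such a walk
    translates the cover by the homology class of the walk.  The colour [p] of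
    [b v] has to be met again on the second round, and a random walk meets it
    only in the vicinity of [b v]; since the level is the same as before, [p]
    is not the colour of the translate of [b v], but is met on exactly one side
    of it, say near [b].  Comparing this picture with its translate by an odd
    closed walk at [v], where the levels are exchanged, shows that [p] would
    have to be met on both sides, which the random walk excludes
    ([good_lifts_absurd]).  Odd walks are essential here: if the graph is
    bipartite, mapping [(x, z)] to the set of the pairs formed by an even vertex
    [c] other than [x] and by the restriction of [z] to the edges at [c] embeds
    each component of the cover into a layer.

    The graph is built as follows.  A core of large girth and large average
    degree provides the edges [b v]; averaging over them makes the colour of
    [b v] differ from the colours of the odd walks at [b] and [v]
    ([exists_sparse_hub_hits]).  A tree of depth [R] in which every node has [q]
    children, with [q] huge, hangs at each vertex of the core, and one edge
    between two of its leaves gives the odd closed walk.  For each core edge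
    [b v], many bridges join leaves of the two trees; an even walk goes down one
    tree, over a bridge and up the other tree.  Each child of a node is reached
    through a different colour, so that redrawing one letter of a random leaf
    shows that the path to it avoids few given colours ([card_down_hits]).  That
    the two paths to the ends of a random bridge have no common colour is a
    property of the whole set of bridges, needed for all colourings at once.
    The nodes of the trees are far fewer than the bridges, so that there are too
    few colourings of the trees to defeat bridges chosen like random ones
    ([exists_balanced_set], [add_bridges]).  All edges are added between vertices
    at distance at least the wanted girth, which exist because balls are small
    compared with the number of leaves ([no_short_cycle_add_edge],
    [card_ball]). *)

(** * Reduced closed walks and short cycles *)

Section Walks.
Variable V : finType.
Implicit Types (e : rel V) (x y a b : V) (w : seq V).

(** A walk is the list [w] of the vertices visited after its start [x]; it is
    reduced when it never goes back along the edge it has just used. *)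
Fixpoint reduced x w : bool :=
  if w is y :: w' then
    (if w' is z :: _ then z != x else true) && reduced y w'
  else true.

(** Girth at least [k], in the form that passes to covers.  The first and the
    last step of the walk may use the same edge. *)
Definition no_short_cycle e (k : nat) : Prop :=
  forall x w, path e x w -> reduced x w -> last x w = x -> w != [::] ->
    k <= size w.

Definition far e (k : nat) a b : Prop :=
  forall w, path e a w -> last a w = b -> k <= size w.

Definition add_edge e a b : rel V :=
  fun x y => e x y || ((x == a) && (y == b)) || ((x == b) && (y == a)).

Lemma add_edge_sym e a b : symmetric e -> symmetric (add_edge e a b).
Proof.
move=> es x y; rewrite /add_edge es -!orbA; congr (_ || _).
by rewrite orbC [(x == b) && _]andbC [(x == a) && _]andbC.
Qed.

Lemma add_edge_irrefl e a b :
  a != b -> irreflexive e -> irreflexive (add_edge e a b).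
Proof.
move=> ab ei x; rewrite /add_edge ei /=.
by case: (x =P a) => [->|_]; rewrite ?(negPf ab) ?andbF.
Qed.

Lemma reduced_cat x w1 w2 :
  reduced x (w1 ++ w2) -> reduced x w1 && reduced (last x w1) w2.
Proof.
elim: w1 x => [|y w1 IH] x //= /andP[h1 /IH /andP[-> ->]]; rewrite andbT.
by case: w1 h1 {IH} => //= ? ? ->.
Qed.

Lemma path_add_edge_split e a b x w :
  path (add_edge e a b) x w ->
  path e x w \/
  exists w1 y w2, [/\ w = w1 ++ y :: w2, path e x w1,
    path (add_edge e a b) y w2 &
    (last x w1 == a) && (y == b) || (last x w1 == b) && (y == a)].
Proof.
elim: w x => [|y w IH] x /=; first by left.
move=> /andP[]; rewrite {1}/add_edge -orbA => /orP[exy|hn] pw.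
  case: (IH _ pw) => [pe|[w1 [z [w2 [-> p1 p2 h]]]]]; first by left; rewrite exy.
  by right; exists (y :: w1), z, w2; rewrite /= exy.
by right; exists [::], y, w.
Qed.

Lemma far_sym e k a b : symmetric e -> far e k a b -> far e k b a.
Proof.
move=> es h w pw lw; have := h (rev (belast b w)).
rewrite size_rev size_belast; apply.
  by rewrite -lw rev_path; apply: sub_path pw => x y; rewrite es.
by case: w pw lw => [|y w] _ //= ; rewrite rev_cons last_rcons.
Qed.

(** Cut a reduced closed walk at its passages through the new edge: two
    passages leave between them a segment of old edges that either joins the
    ends of the new edge or is closed and reduced, and a single passage leaves
    the rest of the walk, which joins these ends. *)
Lemma no_short_cycle_add_edge e k a b :
  symmetric e -> no_short_cycle e k -> far e k a b ->
  no_short_cycle (add_edge e a b) k.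
Proof.
move=> es nc fab x w pw rw lw wn; rewrite leqNgt; apply/negP => lt.
have fba := far_sym es fab.
case: (path_add_edge_split pw) => [pe|].
  by have := nc _ _ pe rw lw wn; rewrite leqNgt lt.
move=> [w1 [y [w2 [ew p1 p2 h1]]]].
have far1 : forall w', path e y w' -> last y w' = last x w1 -> k <= size w'.
  move=> w' pw' lw'; case/orP: h1 => /andP[/eqP h /eqP hy].
    by apply: fba; rewrite -?hy // lw' h.
  by apply: fab; rewrite -?hy // lw' h.
move: rw lw lt; rewrite ew size_cat last_cat /= => rw lw lt.
have /andP[_ /= /andP[hbt r2]] := reduced_cat rw.
case: (path_add_edge_split p2) => [pe2|].
  have := far1 (w2 ++ w1); rewrite cat_path pe2 last_cat lw p1 size_cat.
  by move=> /(_ isT erefl); move: lt; clear; lia.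
move=> [w3 [z [w4 [ew2 p3 _ h2]]]].
move: hbt r2 lt; rewrite ew2 size_cat /= => hbt r2 lt.
have [ly|ny] := eqVneq (last y w3) y.
  case: w3 p3 {ew2} ly h2 hbt r2 lt => [|u w3] p3 ly h2 hbt r2 lt.
    move: hbt; rewrite /= => /eqP; apply.
    move: h1 h2 => /= /orP[]/andP[/eqP -> /eqP ->] /orP[]/andP[/eqP h /eqP ->];
    by rewrite ?h.
  have /andP[r3 _] := reduced_cat r2.
  by have := nc _ _ p3 r3 ly isT; move: lt => /=; clear; lia.
have := far1 _ p3.
suff -> : last y w3 = last x w1 by move=> /(_ erefl); move: lt; clear; lia.
move: h1 h2 ny => /orP[]/andP[/eqP-> /eqP ->] /orP[]/andP[/eqP -> _] //;
by rewrite eqxx.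
Qed.

Definition max_degree e (D : nat) : Prop := forall x, #|e x| <= D.

Definition ball e (n : nat) a : {set V} :=
  iter n (fun B : {set V} => B :|: \bigcup_(x in B) [set y | e x y]) [set a].

Lemma last_in_ball e n a w :
  path e a w -> size w <= n -> last a w \in ball e n a.
Proof.
elim: n w => [|n IH] w.
  by case: w => //= _ _; rewrite inE.
elim/last_ind: w => [|w y _] pw sw.
  by rewrite inE; apply/orP; left; apply: (IH [::]).
move: pw sw; rewrite rcons_path size_rcons last_rcons => /andP[pw ey] sw.
rewrite inE; apply/orP; right; apply/bigcupP; exists (last a w); last by rewrite inE.
exact: IH.
Qed.

Lemma card_ball e D n a : max_degree e D -> #|ball e n a| <= D.+1 ^ n.
Proof.
move=> hD; elim: n => [|n IH]; first by rewrite cards1.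
rewrite expnS /ball iterS -/(ball e n a).
apply: leq_trans (leq_of_leqif (leq_card_setU _ _)) _.
rewrite mulSn leq_add //.
apply: leq_trans (_ : \sum_(x in ball e n a) #|[set y | e x y]| <= _).
  elim/big_rec2: _ => [|x s A _ h]; first by rewrite cards0.
  by apply: leq_trans (leq_of_leqif (leq_card_setU _ _)) _; rewrite leq_add2l.
apply: leq_trans (_ : \sum_(x in ball e n a) D <= _).
  by apply: leq_sum => x _; rewrite cardsE; apply: hD.
by rewrite sum_nat_const mulnC leq_mul2l IH orbT.
Qed.

Lemma far_outside_ball e k a b : b \notin ball e k a -> far e k a b.
Proof.
move=> nb w pw lw; rewrite leqNgt; apply/negP => lt.
by case/negP: nb; rewrite -lw; apply: last_in_ball => //; apply: ltnW.
Qed.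

Lemma far_neq e k a b : 0 < k -> far e k a b -> a != b.
Proof.
by move=> k0 h; apply/eqP => ab; have := h [::] isT ab; rewrite leqNgt k0.
Qed.

Lemma card_add_edge e a b x :
  #|add_edge e a b x| <= #|e x| + ((x == a) + (x == b)).
Proof.
apply: leq_trans (_ : #|[set y | e x y] :|:
   ((if x == a then [set b] else set0) :|: (if x == b then [set a] else set0))| <= _).
  apply: subset_leq_card; apply/subsetP => y.
  rewrite -[y \in _]/(add_edge e a b x y) !inE /add_edge.
  by case: (x == a); case: (x == b); rewrite ?inE ?andTb ?andFb ?orbF // -orbA.
apply: leq_trans (leq_of_leqif (leq_card_setU _ _)) _.
rewrite cardsE leq_add2l.
apply: leq_trans (leq_of_leqif (leq_card_setU _ _)) _.
by case: (x == a); case: (x == b); rewrite ?cards1 ?cards0.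
Qed.

Lemma max_degree_add_edge e D a b :
  max_degree e D -> max_degree (add_edge e a b) D.+2.
Proof.
move=> hD x; apply: leq_trans (card_add_edge e a b x) _.
rewrite -addn2; apply: leq_add (hD x) _.
by case: (x == a); case: (x == b).
Qed.

End Walks.

(** * The mod 2 homology cover *)

Section Cover.
Variable V : finType.

(** Mod 2 chains, indexed by all sets of vertices, whether edges or not. *)
Definition chain : Type := {ffun {set V} -> bool}.
HB.instance Definition _ := GRing.Zmodule.on chain.
HB.instance Definition _ := Finite.on chain.

Definition edge_chain (x y : V) : chain := [ffun S => S == [set x; y]].

Lemma edge_chainC x y : edge_chain x y = edge_chain y x.
Proof. by rewrite /edge_chain setUC. Qed.

Lemma chain_addvv (z : chain) : (z + z = 0)%R.
Proof. by apply/ffunP => S; rewrite !ffunE /GRing.add /= addbb. Qed.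

Lemma chain_addK (u z : chain) : (z + u + u = z)%R.
Proof. by rewrite -addrA chain_addvv addr0. Qed.

Fixpoint walk_chain x (w : seq V) : chain :=
  if w is y :: w' then (edge_chain x y + walk_chain y w')%R else 0%R.

Variables (e : rel V) (e_sym : symmetric e) (e_irr : irreflexive e).

(** Up to isomorphism, every component is the cover of a component of the graph
    by the mod 2 homology: the chain records which edges have been used an odd
    number of times. *)
Definition cover_adj : rel (V * chain) :=
  fun p q => e p.1 q.1 && (q.2 == p.2 + edge_chain p.1 q.1)%R.

Lemma cover_adj_sym : symmetric cover_adj.
Proof.
move=> [x z] [y z']; rewrite /cover_adj /= e_sym; congr (_ && _).
by apply/eqP/eqP => ->; rewrite edge_chainC chain_addK.
Qed.

Lemma cover_adj_irrefl : irreflexive cover_adj.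
Proof. by move=> [x z]; rewrite /cover_adj e_irr. Qed.

Definition homology_cover : sgraph := SGraph cover_adj_sym cover_adj_irrefl.

Lemma reduced_nth (T : finType) (d x : T) w :
  (forall i, i.+1 < size w -> nth d (x :: w) i != nth d (x :: w) i.+2) ->
  reduced x w.
Proof.
elim: w x => [|y w IH] x //= h; apply/andP; split.
  by case: w h {IH} => //= z w /(_ 0 isT); rewrite eq_sym.
by apply: IH => i hi; apply: (h i.+1).
Qed.

(** Two consecutive traversals of the same edge return to the same vertex of
    the cover, so that a cycle of the cover projects to a reduced walk. *)
Lemma cover_girth k : no_short_cycle e k -> girth_at_least homology_cover k.
Proof.
move=> nc; rewrite /girth_at_least /girth.
set s := [seq _ <- _ | _]; case es : s => [|g s'] //=.
have : g \in s by rewrite es inE eqxx.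
rewrite mem_filter => /andP[/andP[g2 /existsP[c /andP[cy un]]] _].
case ec : (tval c) cy un => [|p s0] /=.
  by move: (size_tuple c) g2; rewrite ec /= => <-.
move=> pc un; have sz : (size s0).+1 = g by rewrite -(size_tuple c) ec.
have szp : size (p :: s0) = g by [].
pose w := rcons s0 p.
have stp : forall i, i < size w ->
   cover_adj (nth p (p :: w) i) (nth p (p :: w) i.+1).
  by move=> i hi; apply: (pathP p pc).
have sw : size w = g by rewrite size_rcons.
rewrite -sw -(size_map (fun q : homology_cover => q.1)).
apply: (nc p.1).
- rewrite path_map; apply: sub_path pc => q q' /=.
  by case/andP.
- apply: (@reduced_nth _ p.1) => i; rewrite size_map sw => hi.
  have nthw : forall j, j <= g -> nth p.1 (p.1 :: [seq q.1 | q <- w]) j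
      = (nth p (p :: w) j).1.
    move=> j hj; rewrite -(nth_map p p.1 (fun q : homology_cover => q.1)) //.
    by rewrite /= sw.
  have hi0 : i <= g by move: hi; clear; lia.
  rewrite (nthw i hi0) (nthw i.+2 hi).
  have i1 : i < size w by rewrite sw; apply: ltnW.
  have i2 : i.+1 < size w by rewrite sw.
  have /andP[_ /eqP h1] := stp i i1.
  have /andP[_ /eqP h2] := stp i.+1 i2.
  apply/eqP => h; move: h2; rewrite h1 -h edge_chainC chain_addK => h2.
  have {h h2} : nth p (p :: w) i.+2 = nth p (p :: w) i.
    move: h h2; case: (nth p (p :: w) i.+2) => a1 b1.
    by case: (nth p (p :: w) i) => a2 b2 /= -> ->.
  have nths : forall j, j < g -> nth p (p :: w) j = nth p (p :: s0) j.
    move=> [|j] //= hj; rewrite nth_rcons; case: ltnP => // hj2.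
    by move: hj; rewrite -szp /= ltnS ltnNge hj2.
  rewrite (nths i) ?(ltn_trans _ hi) //.
  have [hi2|hi2] := ltnP i.+2 g.
    rewrite nths // => /eqP; rewrite nth_uniq ?szp //; last by apply: ltnW.
    by clear; lia.
  have -> : i.+2 = g by move: hi hi2; clear; lia.
  rewrite -{1}sz /= nth_rcons ltnn eqxx => /eqP.
  rewrite -{1}[p]/(nth p (p :: s0) 0) nth_uniq ?szp //; move: g2 hi hi2; clear; lia.
- by rewrite last_map last_rcons.
- by rewrite /w; case: (s0).
Qed.

(** The boundary of the chain plus the base vertex.  It is constant along the
    edges of the cover, and together with the chain it determines the base
    vertex, which the chain alone does not. *)
Definition vertex_bits (p : V * chain) (v : V) : bool :=
  ((\sum_(S : {set V} | v \in S) (p.2 S : bool)) + (v == p.1))%R.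

Definition is_edge (S : {set V}) : bool :=
  [exists a, exists b, e a b && (S == [set a; b])].

Definition cube_coord : finType := (({set V} * bool) + V)%type.

(** A set of vertices that is not an edge gets two equal coordinates, so that
    changing the chain there does not give adjacent points of the cube. *)
Definition cube_bits (p : V * chain) (t : cube_coord) : bool :=
  match t with
  | inl Sd => (Sd.2 || ~~ is_edge Sd.1) && p.2 Sd.1
  | inr v => vertex_bits p v
  end.

Definition cube_point (p : homology_cover) : hypercube #|cube_coord| :=
  [ffun i => cube_bits p (enum_val i)].

Lemma cube_pointE p q :
  hc_adj (cube_point p) (cube_point q) =
  (#|[set t | cube_bits p t != cube_bits q t]| == 1).
Proof.
rewrite /hc_adj; congr (_ == 1).
rewrite -(card_imset _ enum_val_inj); apply: eq_card => t.
rewrite inE; apply/imsetP/idP.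
  by move=> [i]; rewrite inE !ffunE => h ->.
by move=> h; exists (enum_rank t); rewrite ?inE ?ffunE ?enum_rankK.
Qed.

Lemma vertex_bits_step x y z :
  x != y -> vertex_bits (y, z + edge_chain x y)%R =1 vertex_bits (x, z).
Proof.
move=> xy v; rewrite /vertex_bits /=.
under eq_bigr => S _ do rewrite ffunE.
rewrite big_split /= -!addrA; congr (_ + _)%R.
have -> : (\sum_(S : {set V} | v \in S) (edge_chain x y S : bool))%R =
          (v \in [set x; y]).
  case: (boolP (v \in [set x; y])) => hv.
    rewrite (bigD1 [set x; y]) //= ffunE eqxx big1 ?addr0 // => S /andP[_ h].
    by rewrite ffunE (negPf h).
  rewrite big1 // => S hS; rewrite ffunE; case: eqP => // h.
  by move: hv; rewrite -h hS.
rewrite !inE; case: (v =P x) => [->|_]; case: (_ =P y) => // h.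
by rewrite h eqxx in xy.
Qed.

Lemma cube_bits_inj p q : cube_bits p =1 cube_bits q -> p = q.
Proof.
case: p q => [x z] [y z'] h.
have hz : z = z'.
  by apply/ffunP => S; have := h (inl (S, true)).
congr (_, _) => //; have := h (inr x); rewrite /= /vertex_bits /= hz eqxx.
by move/addrI; case: eqP.
Qed.

(** Adjacent points of the cube differ in one value of the chain, at an edge
    [S] of the graph; as they agree on [vertex_bits], their base vertices are
    the two ends of [S]. *)
Lemma cover_induced : induced_embeds homology_cover (hypercube #|cube_coord|).
Proof.
exists cube_point.
  move=> p q h; apply: cube_bits_inj => t.
  have := congr1 (fun f : {ffun _ -> bool} => f (enum_rank t)) h.
  by rewrite !ffunE enum_rankK.
move=> p q; change (cover_adj p q = hc_adj (cube_point p) (cube_point q)).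
rewrite cube_pointE; case: p q => [x z] [y z'].
apply/idP/cards1P.
  move=> /andP[/= exy /eqP ->]; exists (inl ([set x; y], true)).
  have xy : x != y by apply/eqP => h; move: exy; rewrite h e_irr.
  apply/setP => -[[S d]|v]; rewrite !inE /=; last first.
    by rewrite vertex_bits_step ?eqxx.
  rewrite ffunE /edge_chain ffunE.
  case: (S =P [set x; y]) => [->|nS]; last first.
    rewrite addr0 eqxx; symmetry; apply/eqP => -[h]; by case: nS.
  have -> : is_edge [set x; y].
    by apply/existsP; exists x; apply/existsP; exists y; rewrite exy eqxx.
  case: d => /=; first by rewrite eqxx; case: (z [set x; y]).
  by symmetry; apply/eqP => -[].
move=> [t ht].
have hd : forall t', (cube_bits (x, z) t' != cube_bits (y, z') t') = (t' == t).
  by move=> t'; have := congr1 (fun A : {set _} => t' \in A) ht; rewrite !inE.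
case: t ht hd => [[S d]|v] ht hd.
  have dT : d.
    case: d ht hd => // ht hd.
    have h1 := hd (inl (S, true)); have := hd (inl (S, false)).
    rewrite eqxx; move: h1; rewrite (_ : (_ == _ :> cube_coord) = false) /=.
      by case: (z S); case: (z' S); case: (is_edge S).
    by apply/eqP => -[].
  rewrite dT in hd; have hz : z' = (z + [ffun S' => S' == S])%R.
    apply/ffunP => S'; rewrite !ffunE; have := hd (inl (S', true)); rewrite /=.
    have -> : ((inl (S', true) : cube_coord) == inl (S, true)) = (S' == S).
      by apply/eqP/eqP => [[]|->].
    by case: (S' == S); case: (z S'); case: (z' S').
  have := hd (inl (S, false)); rewrite /= => hS.
  have /existsP[a /existsP[b /andP[eab /eqP eS]]] : is_edge S.
    case nS : (is_edge S) => //; move: hS; rewrite nS /= hz !ffunE eqxx.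
    rewrite (_ : (_ == _ :> cube_coord) = false); last by apply/eqP => -[].
    by case: (z S).
  have ab : a != b by apply/eqP => h; move: eab; rewrite h e_irr.
  have hv : forall v, vertex_bits (y, z') v = vertex_bits (x, z) v.
    by move=> v; have := hd (inr v); rewrite /= => /negbFE /eqP ->.
  have hz2 : z' = (z + edge_chain a b)%R.
    by rewrite hz eS; congr (_ + _)%R; apply/ffunP => S'; rewrite !ffunE.
  (* The boundary of the edge [S] is the sum of the two base vertices. *)
  have key : forall v, (v == y) = (v \in [set a; b]) (+) (v == x).
    move=> v; have := hv v; rewrite hz2.
    have := vertex_bits_step z ab v; rewrite /vertex_bits /=.
    set s1 := (\sum_(_ | _) _)%R; set s2 := (\sum_(_ | _) _)%R.
    rewrite !inE.
    have : (v == a) && (v == b) = false.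
      by apply/negP => /andP[/eqP -> h]; rewrite h in ab.
    by case: s1; case: s2; case: (v == a); case: (v == b); case: (v == x);
       case: (v == y).
  rewrite /cover_adj /= hz2.
  have nxy : x != y.
    by apply/eqP => h; have := key a; rewrite h !inE eqxx; case: (a == y).
  have hx : x \in [set a; b].
    by have := key x; rewrite (negPf nxy) eqxx; case: (x \in _).
  have hy : y \in [set a; b].
    by have := key y; rewrite eqxx [y == x]eq_sym (negPf nxy); case: (y \in _).
  move: hx hy nxy; rewrite !inE.
  case/orP => /eqP hxa; case/orP => /eqP hyb; rewrite hxa hyb ?eab ?eqxx //.
  by rewrite e_sym eab edge_chainC eqxx.
have hz : z = z'.
  apply/ffunP => S; have := hd (inl (S, true)); rewrite /=.
  by move/negbFE/eqP.
have hdv : forall v', ((v' == x) != (v' == y)) = (v' == v).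
  move=> v'; have := hd (inr v'); rewrite /= /vertex_bits /= hz.
  rewrite (inj_eq (addrI _)) => ->.
  by apply/eqP/eqP => [[]|->].
have := hdv v; rewrite eqxx; case: (x =P y) => [->|nxy]; first by rewrite eqxx.
have := hdv x; rewrite eqxx (introF eqP nxy) => /esym/eqP hx.
have := hdv y; rewrite eqxx eq_sym [y == x]eq_sym (introF eqP nxy) => /esym/eqP hy.
by case: nxy; rewrite hx hy.
Qed.
End Cover.

(** * Edge colourings given by an embedding into a layer *)

(** What an embedding into a layer says about the edges of the cover.  The
    colour of an edge is the coordinate that changes along it, [cut _ _ p] is
    coordinate [p] of the image, and [upper] tells the two levels of the layer
    apart.  Injectivity gives [colour_inj].  By [cut_colour] all the edges of
    one colour are directed alike: coordinate [p] is gained when going up.  This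
    is what distinguishes a layer from the whole cube. *)
Record layer_colouring (V : finType) (e : rel V) (C : finType) := LayerColouring {
  cut : V -> chain V -> C -> bool;
  colour : V -> chain V -> V -> C;
  upper : V -> chain V -> bool;
  cut_step : forall x z y p, e x y ->
    cut y (z + edge_chain x y)%R p = cut x z p (+) (p == colour x z y);
  colour_inj : forall x z y y', e x y -> e x y' ->
    colour x z y = colour x z y' -> y = y';
  cut_colour : forall x z y, e x y -> cut x z (colour x z y) = upper x z;
  upper_step : forall x z y, e x y ->
    upper y (z + edge_chain x y)%R = ~~ upper x z }.

Lemma layered_cover_colouring (V : finType) (e : rel V)
    (e_sym : symmetric e) (e_irr : irreflexive e) :
  layered (homology_cover e_sym e_irr) ->
  exists C : finType, inhabited (layer_colouring e C).
Proof.
move=> [n [k [f finj fadj]]].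
pose g x z : {ffun 'I_n -> bool} := val (f (x, z)).
pose F x z (p : option 'I_n) := if p is Some i then g x z i else false.
pose c x z y := [pick i | g x z i != g y (z + edge_chain x y)%R i].
pose u x z := num_ones (val (f (x, z))) == k.+1.
have hstep x z y (exy : e x y) : exists i,
    [set j | g x z j != g y (z + edge_chain x y)%R j] = [set i].
  apply/cards1P; apply: (fadj (x, z) (y, (z + edge_chain x y)%R)).
  by rewrite /= /cover_adj /= exy eqxx.
have hc x z y (exy : e x y) : exists2 i, c x z y = Some i &
   forall j, (g x z j != g y (z + edge_chain x y)%R j) = (j == i).
  have [i hi] := hstep x z y exy.
  have hj j : (g x z j != g y (z + edge_chain x y)%R j) = (j == i).
    by have := congr1 (fun A : {set _} => j \in A) hi; rewrite !inE.
  exists i => //; rewrite /c; case: pickP => [j|/(_ i)]; rewrite hj ?eqxx //.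
  by move/eqP ->.
have hlay x z : (num_ones (val (f (x, z))) == k) || u x z.
  by have := valP (f (x, z)); rewrite inE.
have huE x z : num_ones (val (f (x, z))) = k + u x z.
  by have := hlay x z; rewrite /u; case: eqP => [->|_] /=; 
     [rewrite ltn_eqF // addn0|move/eqP => ->; rewrite eqxx addn1].
have hnum x z y i (exy : e x y) :
    (forall j, (g x z j != g y (z + edge_chain x y)%R j) = (j == i)) ->
    k + u x z + g y (z + edge_chain x y)%R i
    = k + u y (z + edge_chain x y)%R + g x z i.
  move=> hi; rewrite -!huE /num_ones -/(g x z) -/(g y _).
  have cnt (h : {ffun 'I_n -> bool}) : 
      #|[set j | h j]| = h i + #|[set j | h j] :\ i|.
    by rewrite (cardsD1 i) inE.
  rewrite (cnt (g x z)) (cnt (g y _)).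
  suff -> : #|[set j | g x z j] :\ i| =
            #|[set j | g y (z + edge_chain x y)%R j] :\ i| by clear; lia.
  apply: eq_card => j; rewrite !inE; case: (j =P i) => //= /eqP ji.
  by have := hi j; rewrite (negPf ji) => /negbFE/eqP.
exists (option 'I_n : finType); constructor.
apply: (@LayerColouring V e _ F c u).
- move=> x z y p exy; have [i -> hi] := hc x z y exy.
  case: p => [j|] //=; have := hi j.
  rewrite (inj_eq Some_inj).
  by case: (j == i); case: (g x z j); case: (g y _ j).
- move=> x z y y' exy exy' h.
  have [i hi1 hi2] := hc x z y exy; have [i' hi1' hi2'] := hc x z y' exy'.
  have ii : i = i' by move: h; rewrite hi1 hi1' => -[].
  have : f (y, (z + edge_chain x y)%R) = f (y', (z + edge_chain x y')%R).
    apply: val_inj; apply/ffunP => j; rewrite -/(g y _) -/(g y' _).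
    have := hi2 j; rewrite ii -hi2'.
    by case: (g x z j); case: (g y _ j); case: (g y' _ j).
  by move/finj => -[].
- move=> x z y exy; have [i -> hi] := hc x z y exy.
  have := hnum _ _ _ _ exy hi; have := hi i; rewrite eqxx /=.
  by case: (g x z i); case: (g y _ i); case: (u x z); case: (u y _) => //= _ ; lia.
- move=> x z y exy; have [i _ hi] := hc x z y exy.
  have := hnum _ _ _ _ exy hi; have := hi i; rewrite eqxx /=.
  by case: (g x z i); case: (g y _ i); case: (u x z); case: (u y _) => //= _ ; lia.
Qed.

(** * Six good lifts are contradictory *)

Section LocalContradiction.
Variables (V : finType) (e : rel V) (C : finType) (L : layer_colouring e C).
Hypothesis e_sym : symmetric e.
Local Notation chain := (chain V).
Implicit Types (x y : V) (z : chain) (w : seq V).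

Fixpoint walk_colours x z w : seq C :=
  if w is y :: w' then
    colour L x z y :: walk_colours y (z + edge_chain x y)%R w'
  else [::].

Lemma size_walk_colours x z w : size (walk_colours x z w) = size w.
Proof. by elim: w x z => //= y w IH x z; rewrite IH. Qed.

Lemma walk_colours_cat x z w1 w2 :
  walk_colours x z (w1 ++ w2) =
  walk_colours x z w1 ++ walk_colours (last x w1) (z + walk_chain x w1)%R w2.
Proof. by elim: w1 x z => [|y w1 IH] x z /=; rewrite ?addr0 // IH addrA. Qed.

Lemma cut_walk x z w p : path e x w -> p \notin walk_colours x z w ->
  cut L (last x w) (z + walk_chain x w)%R p = cut L x z p.
Proof.
elim: w x z => [|y w IH] x z /=; first by rewrite addr0.
move=> /andP[exy pw]; rewrite inE negb_or => /andP[np nw].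
by rewrite addrA IH // cut_step // (negPf np) addbF.
Qed.

Lemma upper_walk x z w : path e x w ->
  upper L (last x w) (z + walk_chain x w)%R = upper L x z (+) odd (size w).
Proof.
elim: w x z => [|y w IH] x z /=; first by rewrite addr0 addbF.
move=> /andP[exy pw].
by rewrite addrA IH // upper_step // addbN addNb.
Qed.

Lemma colour_sym x z y : e x y ->
  colour L y (z + edge_chain x y)%R x = colour L x z y.
Proof.
move=> exy; apply/eqP.
have h1 := cut_step L z (colour L x z y) exy.
have eyx : e y x by rewrite e_sym.
have h2 := cut_step L (z + edge_chain x y)%R (colour L x z y) eyx.
move: h2; rewrite h1 edge_chainC chain_addK eqxx eq_sym.
by case: (cut L x z _); case: (_ == _).
Qed.

(** A closed walk of even length through the edge [b v]: from [v] along [X] to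
    [lx], across the edge [lx ly], and back along the reverse of [Y] to [b].
    The walks [delta] and [gamma] are odd and closed.  Adding to a chain the
    chain of a closed walk is a translation of the cover; those by [d] and [g]
    exchange the two levels, and that by [a], the chain of the even walk,
    preserves them. *)
Variables (b v lx ly : V) (X Y delta gamma : seq V).
Hypotheses (ebv : e b v) (exy : e lx ly).
Hypotheses (pX : path e v X) (lX : last v X = lx).
Hypotheses (pY : path e b Y) (lY : last b Y = ly).
Hypothesis sXY : odd (size X + size Y) = false.
Hypotheses (pd : path e v delta) (ld : last v delta = v) (od : odd (size delta)).
Hypotheses (pg : path e b gamma) (lg : last b gamma = b) (og : odd (size gamma)).

Local Notation E := (edge_chain b v).
Local Notation d := (walk_chain v delta).
Local Notation g := (walk_chain b gamma).

(** Colours determined by [z] and by the surroundings of the edge [b v], but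
    not by [X] and [Y]: a random choice of [X] and [Y] avoids them.  The
    entries at [z + d] and [z + g] are meant for lifts [z] of the form [z' + d]
    or [z' + g]: they are then the colour of [b v] at [z']. *)
Definition forbidden z : seq C :=
  [:: colour L b z v; colour L b (z + d)%R v; colour L b (z + g)%R v] ++
  walk_colours v (z + E)%R delta ++ walk_colours b z gamma.

(** The paths from the two ends of [b v] at [z] avoid the forbidden colours up
    to and including the edge [lx ly], and have no common colour before it. *)
Definition good_lift z : bool :=
  [&& ~~ has (mem (forbidden z)) (walk_colours v (z + E)%R (rcons X ly)),
      ~~ has (mem (forbidden z)) (walk_colours b z (rcons Y lx)) &
      ~~ has (mem (walk_colours v (z + E)%R X)) (walk_colours b z Y)].

Definition bridge_chain : chain :=
  (E + walk_chain v X + edge_chain lx ly + walk_chain b Y)%R.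
Local Notation a := bridge_chain.

Section Fixed.
Variable p : C.
Let fb z := cut L b z p.
Let fv z := cut L v (z + E)%R p.
Let fx z := cut L lx (z + E + walk_chain v X)%R p.
Let fy z := cut L ly (z + walk_chain b Y)%R p.

Lemma bridge_chain_Y z : (z + a + walk_chain b Y = z + E + walk_chain v X + edge_chain lx ly)%R.
Proof. by rewrite /a !addrA chain_addK. Qed.

Lemma bridge_chain_X z : (z + a + E + walk_chain v X = z + walk_chain b Y + edge_chain ly lx)%R.
Proof.
rewrite /a (edge_chainC ly); apply/ffunP => S; rewrite !ffunE /GRing.add /=.
by case: (z S); case: (_ == _); case: (walk_chain v X S); case: (_ == _);
   case: (walk_chain b Y S).
Qed.

Lemma notin_rcons_walk x z w y :
  p \notin walk_colours x z (rcons w y) ->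
  (p \notin walk_colours x z w) /\
  p != colour L (last x w) (z + walk_chain x w)%R y.
Proof.
rewrite -cats1 walk_colours_cat mem_cat negb_or /= inE; exact/andP.
Qed.

(** The value of the cut is carried unchanged from each end of [b v] to both
    ends of the edge [lx ly]; the far end belongs to the lift translated by
    [a]. *)
Lemma good_through z : good_lift z -> p \in forbidden z ->
  [/\ fx z = fv z, fy (z + a)%R = fv z, fy z = fb z & fx (z + a)%R = fb z].
Proof.
move=> /and3P[h1 h2 _] pf.
have n1 : p \notin walk_colours v (z + E)%R (rcons X ly).
  by apply: contra h1 => h; apply/hasP; exists p.
have n2 : p \notin walk_colours b z (rcons Y lx).
  by apply: contra h2 => h; apply/hasP; exists p.
have [n11 n12] := notin_rcons_walk n1; have [n21 n22] := notin_rcons_walk n2.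
have A1 : fx z = fv z by rewrite /fx -lX cut_walk.
have A2 : fy z = fb z by rewrite /fy -lY cut_walk.
split=> //.
- by rewrite -A1 /fy bridge_chain_Y cut_step //; rewrite lX in n12; rewrite (negPf n12) addbF.
- rewrite -A2 /fx bridge_chain_X cut_step //; last by rewrite e_sym.
  by rewrite lY in n22; rewrite (negPf n22) addbF.
Qed.

Lemma cross_core_edge z : fb z != fv z ->
  p = colour L b z v /\ fb z = upper L b z.
Proof.
rewrite /fb /fv cut_step //; case: (p =P _) => [->|]; last by rewrite addbF eqxx.
by move=> _; split => //; rewrite cut_colour.
Qed.

Lemma cross_X z : fx z != fv z -> p \in walk_colours v (z + E)%R X.
Proof. by apply: contraR => h; rewrite /fx -lX cut_walk. Qed.

Lemma cross_Y z : fy z != fb z -> p \in walk_colours b z Y.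
Proof. by apply: contraR => h; rewrite /fy -lY cut_walk. Qed.

Lemma good_lift_X z q : good_lift z -> q \in walk_colours v (z + E)%R X ->
  q \notin forbidden z /\ q \notin walk_colours b z Y.
Proof.
move=> /and3P[h1 _ h3] qX; split.
  apply: contra h1 => qf; apply/hasP; exists q => //.
  by rewrite -cats1 walk_colours_cat mem_cat qX.
by apply: contra h3 => qY; apply/hasP; exists q.
Qed.

Lemma good_lift_Y z q : good_lift z -> q \in walk_colours b z Y ->
  q \notin forbidden z.
Proof.
move=> /and3P[_ h1 h3] qY.
apply: contra h1 => qf; apply/hasP; exists q => //.
by rewrite -cats1 walk_colours_cat mem_cat qY.
Qed.

Lemma upper_shift_d z : upper L b (z + d)%R = ~~ upper L b z.
Proof.
have h1 := upper_step L z ebv; have h2 := upper_walk (z + E)%R pd.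
rewrite ld h1 od addbT negbK in h2.
have h3 := upper_step L (z + d)%R ebv.
by move: h3; rewrite addrAC h2 => ->; rewrite negbK.
Qed.

Lemma upper_shift_g z : upper L b (z + g)%R = ~~ upper L b z.
Proof. by have := upper_walk z pg; rewrite lg og addbT. Qed.

Lemma upper_shift_a z : upper L b (z + a)%R = upper L b z.
Proof.
have h1 := upper_step L z ebv; have h2 := upper_walk (z + E)%R pX.
have h3 := upper_step L (z + E + walk_chain v X)%R exy.
have h4 := upper_walk (z + a)%R pY.
move: h4; rewrite lY bridge_chain_Y h3 -{1}lX h2 h1.
move: sXY; rewrite oddD.
by case: (odd (size X)); case: (odd (size Y)); case: (upper L b z);
   case: (upper L b _).
Qed.
End Fixed.

(** Let [p] be the colour of [b v] at [z], and [m] the level of [b] there, so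
    that the cut of [p] is [m] at [b] and [~~ m] at [v].  At [z + a] the two
    ends of [b v] have the same cut value: otherwise the edge has colour [p]
    again, directed as at [z], and so has an edge of [Y], along which the value
    returns from [~~ m] to [m].  If the common value is [m], then [p] is met on
    [Y]; as [d] exchanges the levels, the edge [b v] at [z + d] cannot have
    colour [p], and both of its ends have cut value [~~ m].  At [z + a + d]
    this makes [p] a colour of both [X] and [Y], which a good lift excludes.
    If it is [~~ m], the same happens with [g] in place of [d] and the two ends
    exchanged. *)
Lemma good_lifts_absurd z :
  colour L b z v \notin walk_colours v (z + E)%R delta ->
  colour L b z v \notin walk_colours b z gamma ->
  good_lift z -> good_lift (z + d)%R -> good_lift (z + g)%R ->
  good_lift (z + a)%R -> good_lift (z + a + d)%R -> good_lift (z + a + g)%R ->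
  False.
Proof.
set p := colour L b z v => pnd png good0 goodd goodg gooda goodad goodag.
pose fb z := cut L b z p.
pose fv z := cut L v (z + E)%R p.
pose fx z := cut L lx (z + E + walk_chain v X)%R p.
pose fy z := cut L ly (z + walk_chain b Y)%R p.
pose m := upper L b z.
have fv_d z' : p \notin walk_colours v (z' + E)%R delta -> fv (z' + d)%R = fv z'.
  by move=> nd; have := cut_walk pd nd; rewrite ld /fv addrAC.
have fb_g z' : p \notin walk_colours b z' gamma -> fb (z' + g)%R = fb z'.
  by move=> ng; have := cut_walk pg ng; rewrite lg.
have fb0 : fb z = m by rewrite /fb /p cut_colour.
have fv0 : fv z = ~~ m by rewrite /fv cut_step // eqxx addbT -fb0.
have pf0 : p \in forbidden z by rewrite inE eqxx.
have pfd : p \in forbidden (z + d)%R by rewrite !inE chain_addK eqxx orbT.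
have pfg : p \in forbidden (z + g)%R by rewrite !inE chain_addK eqxx !orbT.
have [_ ya _ xa] := good_through good0 pf0.
rewrite -/(fy _) -/(fv _) -/(fx _) -/(fb _) fv0 fb0 in ya xa.
have cya : fy (z + a)%R != fb (z + a)%R -> p \notin forbidden (z + a)%R.
  by move=> h; apply: (good_lift_Y gooda); apply: cross_Y.
have cxa : fx (z + a)%R != fv (z + a)%R -> p \notin forbidden (z + a)%R.
  by move=> h; have [] := good_lift_X gooda (cross_X h).
(* Otherwise [b v] at [z + a] has colour [p], which [Y] has to cross there. *)
have fba_fva : fb (z + a)%R = fv (z + a)%R.
  apply/eqP/negPn/negP => h; have [h1 h2] := cross_core_edge h.
  have h3 : p \in forbidden (z + a)%R by rewrite h1 inE eqxx.
  have h4 : fb (z + a)%R = m by rewrite /fb h2 upper_shift_a.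
  by move: cya; rewrite h3 ya h4; case: (m) => /(_ isT).
have [fbE|fbE] := eqVneq (fb (z + a)%R) m.
- have pYa : p \in walk_colours b (z + a)%R Y.
    by apply: cross_Y; rewrite -/(fy _) -/(fb _) ya fbE; case: (m).
  have := good_lift_Y gooda pYa; rewrite !mem_cat !negb_or => /and3P[_ nd _].
  have fvad : fv (z + a + d)%R = m.
    by rewrite fv_d // -fba_fva fbE.
  have fvd : fv (z + d)%R = ~~ m.
    by rewrite fv_d.
  (* Crossing [b v] at [z + d] would direct the colour [p] the wrong way. *)
  have fbd : fb (z + d)%R = ~~ m.
    apply/eqP/negPn/negP => h; have : fb (z + d)%R != fv (z + d)%R by rewrite fvd.
    by move/cross_core_edge => [_]; rewrite -/(fb _) upper_shift_d => h'; rewrite h' eqxx in h.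
  have [_ yd _ xd] := good_through goodd pfd.
  rewrite -/(fy _) -/(fv _) -/(fx _) -/(fb _) fvd fbd addrAC in yd xd.
  have pX' : p \in walk_colours v (z + a + d + E)%R X.
    by apply: cross_X; rewrite -/(fx _) -/(fv _) xd fvad; case: (m).
  have [nf nY] := good_lift_X goodad pX'.
  case/negP: nY; apply: cross_Y; rewrite -/(fy _) -/(fb _) yd.
  suff -> : fb (z + a + d)%R = m by case: (m).
  rewrite -fvad; apply/eqP/negPn/negP => /cross_core_edge[h _].
  by case/negP: nf; rewrite h inE eqxx.
- have fbN : fb (z + a)%R = ~~ m by move: fbE; case: (fb _); case: (m).
  have pXa : p \in walk_colours v (z + a + E)%R X.
    by apply: cross_X; rewrite -/(fx _) -/(fv _) xa -fba_fva fbN; case: (m).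
  have [+ _] := good_lift_X gooda pXa; rewrite !mem_cat !negb_or => /and3P[_ _ ng].
  have fbag : fb (z + a + g)%R = ~~ m.
    by rewrite fb_g.
  have fbg : fb (z + g)%R = m by rewrite fb_g.
  have fvg : fv (z + g)%R = m.
    apply/eqP/negPn/negP => h; have : fb (z + g)%R != fv (z + g)%R.
      by rewrite fbg eq_sym.
    move/cross_core_edge => [_]; rewrite -/(fb _) upper_shift_g fbg -/m.
    by case: (m).
  have [_ yd _ xd] := good_through goodg pfg.
  rewrite -/(fy _) -/(fv _) -/(fx _) -/(fb _) fvg fbg addrAC in yd xd.
  have pY' : p \in walk_colours b (z + a + g)%R Y.
    by apply: cross_Y; rewrite -/(fy _) -/(fb _) yd fbag; case: (m).
  have nf := good_lift_Y goodag pY'.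
  have fvag : fv (z + a + g)%R = ~~ m.
    rewrite -fbag; apply/eqP/negPn/negP; rewrite eq_sym => /cross_core_edge[h _].
    by case/negP: nf; rewrite h inE eqxx.
  have pX' : p \in walk_colours v (z + a + g + E)%R X.
    by apply: cross_X; rewrite -/(fx _) -/(fv _) xd fvag; case: (m).
  by have [_ /negP] := good_lift_X goodag pX'; apply.
Qed.

End LocalContradiction.

(** * Words and trees *)

Lemma card_sum_nat (T : finType) (P : pred T) :
  #|[set a | P a]| = \sum_a (P a : nat).
Proof.
by rewrite -sum1dep_card big_mkcond /=; apply: eq_bigr => a _; case: (P a).
Qed.

Section Words.
Variables (R : nat) (A : finType) (a0 : A).
Local Notation word := {ffun 'I_R -> A}.
Implicit Types (s x : word) (i : 'I_R).

Definition set_letter s i a : word := [ffun j => if j == i then a else s j].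

(** The node at depth [n] above the leaf [s]: letters from [n] on are reset to
    [a0], so that a node is determined by its depth and its word. *)
Definition prefix_word (n : nat) s : word :=
  [ffun j : 'I_R => if j < n then s j else a0].

Lemma prefix_word_all s : prefix_word R s = s.
Proof. by apply/ffunP => j; rewrite ffunE ltn_ord. Qed.

Lemma prefix_word0 s : prefix_word 0 s = [ffun=> a0].
Proof. by apply/ffunP => j; rewrite !ffunE. Qed.

Lemma prefix_word_prefix m n s :
  m <= n -> prefix_word m (prefix_word n s) = prefix_word m s.
Proof.
move=> mn; apply/ffunP => j; rewrite !ffunE.
by case: ltnP => // jm; rewrite (leq_trans jm mn).
Qed.

Lemma prefix_word_set n s i a :
  n <= i -> prefix_word n (set_letter s i a) = prefix_word n s.
Proof.
move=> ni; apply/ffunP => j; rewrite !ffunE; case: ltnP => // jn.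
by case: eqP => // ji; move: jn; rewrite ji ltnNge ni.
Qed.

Lemma prefix_wordS_set s i a :
  prefix_word i.+1 (set_letter s i a) = set_letter (prefix_word i.+1 s) i a.
Proof.
apply/ffunP => j; rewrite !ffunE; case: (j =P i) => [->|//].
by rewrite ltnSn.
Qed.

Lemma set_prefix_wordS s i :
  set_letter (prefix_word i.+1 s) i a0 = prefix_word i s.
Proof.
apply/ffunP => j; rewrite !ffunE ltnS leq_eqVlt; case: (j =P i) => [->|/eqP h].
  by rewrite ltnn.
have -> : (j == i :> nat) = false by apply: negbTE.
by [].
Qed.

Lemma set_letter_set s i a c :
  set_letter (set_letter s i a) i c = set_letter s i c.
Proof. by apply/ffunP => j; rewrite !ffunE; case: eqP. Qed.

Lemma set_letter_inj s i : injective (set_letter s i).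
Proof.
by move=> a c h; have := congr1 (fun t : word => t i) h; rewrite !ffunE eqxx.
Qed.

(** Resampling: a uniform word stays uniform when one letter is redrawn. *)
Lemma card_resample (B : pred word) i M :
  (forall s, #|[set a | B (set_letter s i a)]| <= M) ->
  #|A| * #|[set s | B s]| <= M * #|{: word}|.
Proof.
move=> hM.
have e1 : \sum_(s : word) \sum_(a : A) (B (set_letter s i a) : nat) <=
          M * #|{: word}|.
  rewrite mulnC -sum_nat_const; apply: leq_sum => s _.
  by rewrite -card_sum_nat.
apply: leq_trans e1; rewrite pair_big /=.
pose h (p : word * A) := (set_letter p.1 i p.2, p.1 i).
have hh : involutive h.
  move=> [s a]; rewrite /h /= set_letter_set ffunE eqxx; congr (_, _).
  by apply/ffunP => j; rewrite ffunE; case: eqP => // ->.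
rewrite (reindex_inj (inv_inj hh)) /=.
have -> : \sum_(p : word * A) (B (set_letter (set_letter p.1 i p.2) i (p.1 i)) : nat)
   = \sum_(s : word) \sum_(a : A) (B s : nat).
  rewrite pair_big /=; apply: eq_bigr => -[s a] _ /=.
  rewrite set_letter_set; congr (nat_of_bool (B _)).
  by apply/ffunP => j; rewrite ffunE; case: eqP => // ->.
under eq_bigr => s _ do rewrite sum_nat_const.
by rewrite -big_distrr /= card_sum_nat.
Qed.
End Words.

Lemma card_inj_preim (A : finType) (C : eqType) (f : A -> C) (Q : seq C)
    (P : pred A) :
  (forall a c, P a -> P c -> f a = f c -> a = c) ->
  #|[set a | P a && (f a \in Q)]| <= size Q.
Proof.
move=> finj; rewrite cardE -(size_map f); apply: uniq_leq_size.
  rewrite map_inj_in_uniq ?enum_uniq // => a c.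
  by rewrite !mem_enum !inE => /andP[pa _] /andP[pc _]; apply: finj.
by move=> q /mapP[a]; rewrite mem_enum inE => /andP[_ h] ->.
Qed.

Section Trees.
Variables (U : finType) (R : nat) (A : finType) (a0 : A).
Local Notation word := {ffun 'I_R -> A}.
(** One complete [A]-ary tree of depth [R] for each [u].  Triples whose word has
    a letter other than [a0] beyond their depth are not on a path from the root
    to a leaf; they form further components, which are trees as well. *)
Definition tree_vertex : finType := (U * 'I_R.+1 * word)%type.
Local Notation V := tree_vertex.

Definition node (u : U) (i : nat) (s : word) : V := (u, inord i, s).
Definition tree_root u : V := node u 0 [ffun=> a0].
Definition leaf u x : V := node u R x.

Definition down_to (n : nat) u x : seq V :=
  [seq node u j.+1 (prefix_word a0 j.+1 x) | j <- iota 0 n].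
Definition down u x := down_to R u x.

Lemma down_toS n u x :
  down_to n.+1 u x = rcons (down_to n u x) (node u n.+1 (prefix_word a0 n.+1 x)).
Proof.
rewrite /down_to; have -> : iota 0 n.+1 = rcons (iota 0 n) n.
  by rewrite -cats1 -addn1 iotaD.
by rewrite map_rcons.
Qed.

Lemma size_down u x : size (down u x) = R.
Proof. by rewrite size_map size_iota. Qed.

Lemma last_down_to n u x :
  last (tree_root u) (down_to n u x) = node u n (prefix_word a0 n x).
Proof.
case: n => [|n]; first by rewrite /= prefix_word0.
by rewrite down_toS last_rcons.
Qed.

Lemma last_down u x : last (tree_root u) (down u x) = leaf u x.
Proof. by rewrite last_down_to prefix_word_all. Qed.

Lemma down_to_prefix n m u x :
  n <= m -> down_to n u (prefix_word a0 m x) = down_to n u x.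
Proof.
move=> nm; apply/eq_in_map => j; rewrite mem_iota /= add0n => jn.
by rewrite prefix_word_prefix //; apply: leq_trans jn nm.
Qed.

Lemma down_to_eq n u x y :
  prefix_word a0 n x = prefix_word a0 n y -> down_to n u x = down_to n u y.
Proof.
by move=> h; rewrite -(down_to_prefix u x (leqnn n)) h down_to_prefix.
Qed.

Variable e : rel V.
Hypothesis e_tree : forall u (i : 'I_R) s,
  e (node u i (set_letter s i a0)) (node u i.+1 s).

Lemma path_down_to n u x : n <= R -> path e (tree_root u) (down_to n u x).
Proof.
elim: n => [|n IH] nR //; rewrite down_toS rcons_path IH ?(ltnW nR) //=.
rewrite last_down_to -(set_prefix_wordS a0 x (Ordinal nR)).
exact: (e_tree u (Ordinal nR)).
Qed.

Lemma path_down u x : path e (tree_root u) (down u x).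
Proof. exact: path_down_to. Qed.

Section Colours.
Variables (C : finType) (L : layer_colouring e C) (u : U) (z : chain V).

(** The colour of the edge from the parent of the node [s] of depth [i.+1] to
    this node, in the lift of the tree whose root lies at [z]. *)
Definition node_colour (i : 'I_R) (s : word) : C :=
  colour L (node u i (set_letter s i a0))
    (z + walk_chain (tree_root u) (down_to i u s))%R (node u i.+1 s).

Lemma walk_colours_down_toS (i : 'I_R) x :
  walk_colours L (tree_root u) z (down_to i.+1 u x) =
  rcons (walk_colours L (tree_root u) z (down_to i u x))
        (node_colour i (prefix_word a0 i.+1 x)).
Proof.
rewrite down_toS -cats1 walk_colours_cat /= cats1; congr (rcons _ _).
rewrite /node_colour set_prefix_wordS last_down_to.
by rewrite (down_to_prefix u x (leqnSn i)).
Qed.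

Lemma mem_walk_colours_down x p :
  p \in walk_colours L (tree_root u) z (down u x) ->
  exists i : 'I_R, p = node_colour i (prefix_word a0 i.+1 x).
Proof.
suff H n : n <= R -> p \in walk_colours L (tree_root u) z (down_to n u x) ->
  exists i : 'I_R, p = node_colour i (prefix_word a0 i.+1 x) by apply: H.
elim: n => // n IH nR; rewrite (walk_colours_down_toS (Ordinal nR)).
rewrite mem_rcons inE => /orP[/eqP ->|]; first by exists (Ordinal nR).
by apply: IH; apply: ltnW.
Qed.

Lemma node_colour_inj i s :
  injective (fun a => node_colour i (set_letter s i a)).
Proof.
move=> a c; rewrite /node_colour !set_letter_set.
have dE a' : down_to i u (set_letter s i a') = down_to i u s.
  by apply: down_to_eq; rewrite prefix_word_set.
rewrite !dE => /colour_inj h.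
have ee a' : e (node u i (set_letter s i a0)) (node u i.+1 (set_letter s i a')).
  by have := e_tree u i (set_letter s i a'); rewrite set_letter_set.
by have := h (ee a) (ee c) => -[]; apply: set_letter_inj.
Qed.

(** Among the children of a tree node at most [size Q] are reached through a
    colour of [Q], whence the bound by resampling each letter of the leaf. *)
Lemma card_down_hits (Q : seq C) :
  #|A| * #|[set x | has (mem Q) (walk_colours L (tree_root u) z (down u x))]|
  <= R * size Q * #|{: word}|.
Proof.
suff H n : n <= R ->
  #|A| * #|[set x | has (mem Q) (walk_colours L (tree_root u) z (down_to n u x))]|
  <= n * size Q * #|{: word}| by apply: H.
elim: n => [|n IH] nR.
  by rewrite (eq_card0 (A := [set x | _])) ?muln0 // => x; rewrite inE.
pose B x := node_colour (Ordinal nR) (prefix_word a0 n.+1 x) \in Q.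
have hB : #|A| * #|[set x | B x]| <= size Q * #|{: word}|.
  apply: (@card_resample _ _ _ (Ordinal nR)) => s.
  rewrite /B; have E a : prefix_word a0 n.+1 (set_letter s (Ordinal nR) a) =
     set_letter (prefix_word a0 n.+1 s) (Ordinal nR) a.
    exact: (prefix_wordS_set a0 s (Ordinal nR)).
  apply: leq_trans (card_inj_preim (P := predT)
    (f := fun a => node_colour (Ordinal nR)
                   (set_letter (prefix_word a0 n.+1 s) (Ordinal nR) a)) Q _).
    by apply: subset_leq_card; apply/subsetP => a; rewrite !inE E.
  by move=> a c _ _; apply: node_colour_inj.
have := IH (ltnW nR); set D := [set x | has _ _] => hD.
apply: leq_trans (_ : #|A| * (#|D| + #|[set x | B x]|) <= _).
  rewrite leq_mul2l; apply/orP; right.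
  apply: leq_trans (leq_of_leqif (leq_card_setU _ _)).
  apply: subset_leq_card; apply/subsetP => x; rewrite !inE.
  by rewrite (walk_colours_down_toS (Ordinal nR)) has_rcons orbC.
by rewrite mulnDr mulSn mulnDl addnC leq_add.
Qed.
End Colours.
End Trees.

(** * Graphs whose cover is not layered *)

Section Robust.
Variables (U : finType) (R : nat) (A : finType) (a0 : A).
Local Notation word := {ffun 'I_R -> A}.
Local Notation V := (tree_vertex U R A).
Local Notation root := (@tree_root U R A a0).
Local Notation prefix_word := (prefix_word a0).

Definition clash (cX cY : 'I_R * word -> 'I_R * word) (p : word * word) : bool :=
  [exists i : 'I_R, exists j : 'I_R,
    cX (i, prefix_word i.+1 p.1) == cY (j, prefix_word j.+1 p.2)].

Definition sibling_injective (cX : 'I_R * word -> 'I_R * word) : Prop :=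
  forall i s, injective (fun a => cX (i, set_letter s i a)).

(** The pair of leaves given by a random bridge behaves like two independent
    leaves, as far as clashes are concerned. *)
Definition jointly_spread (Z : {set word * word}) : Prop :=
  forall cX cY, sibling_injective cX ->
    32 * #|[set p in Z | clash cX cY p]| <= #|Z|.

(** [bridging e b v Z]: the pairs of [Z] are edges from leaves at [v] to leaves
    at [b].  The caps make the leaves of a random bridge nearly uniform. *)
Record bridging (e : rel V) (b v : U) (Z : {set word * word}) : Prop := Bridging {
  bridging_edge : forall p, p \in Z -> e (leaf v p.1) (leaf b p.2);
  bridging_cap1 : forall x, #|[set p in Z | p.1 == x]| <= #|A|;
  bridging_cap2 : forall y, #|[set p in Z | p.2 == y]| <= #|A|;
  bridging_spread : jointly_spread Z }.

Variables (e : rel V) (e_sym : symmetric e) (e_irr : irreflexive e).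
Hypothesis e_tree : forall u (i : 'I_R) s,
  e (node u i (set_letter s i a0)) (node u i.+1 s).
(** The roots are the vertices of the core [K], and an odd closed walk of
    length at most [l] leaves each of them. *)
Variables (K : rel U) (K_sym : symmetric K).
Hypothesis e_core : forall u w, K u w -> e (root u) (root w).
Variables (l : nat) (gamma : U -> seq V).
Hypothesis gamma_path : forall u, path e (root u) (gamma u).
Hypothesis gamma_last : forall u, last (root u) (gamma u) = root u.
Hypothesis gamma_odd : forall u, odd (size (gamma u)).
Hypothesis gamma_size : forall u, size (gamma u) <= l.

Section Layered.
Variables (C : finType) (L : layer_colouring e C).
Local Notation chain := (chain V).

Section Bridge.
Variables (b v : U) (Z : {set word * word}).
Hypothesis Kbv : K b v.
Hypothesis hZ : bridging e b v Z.
Hypothesis Zbig : 64 * (R.+1 * (3 + 2 * l) * #|{: word}|) <= #|Z|.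

Let good (p : word * word) (z : chain) : bool :=
  good_lift L (root b) (root v) (leaf v p.1) (leaf b p.2)
    (down a0 v p.1) (down a0 b p.2) (gamma v) (gamma b) z.

Lemma cap_count (f : word * word -> word) (D : {set word}) :
  (forall x, #|[set p in Z | f p == x]| <= #|A|) ->
  #|[set p in Z | f p \in D]| <= #|A| * #|D|.
Proof.
move=> cap; rewrite mulnC -sum_nat_const.
apply: leq_trans (_ : \sum_(x in D) #|[set p in Z | f p == x]| <= _); last first.
  by apply: leq_sum => x _; apply: cap.
rewrite -sum1_card (partition_big f (mem D)) /=; last first.
  by move=> p; rewrite inE => /andP[].
apply: leq_sum => x xD; rewrite -sum1_card; apply: eq_leq.
apply: eq_bigl => p; rewrite !inE -andbA; congr (_ && _).
by case: eqP => [->|]; rewrite ?andbF // xD.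
Qed.

Lemma leaf_inj u : injective (@leaf U R A u).
Proof. by move=> x y []. Qed.

(** Distinct bridges at the same leaf have distinct colours. *)
Lemma card_leaf_hits (Q : seq C) (zz : word -> chain) :
  #|[set p in Z | colour L (leaf v p.1) (zz p.1) (leaf b p.2) \in Q]|
  <= #|{: word}| * size Q.
Proof.
rewrite -sum_nat_const -sum1_card (partition_big (fun p => p.1) predT) //=.
apply: leq_sum => x _; rewrite sum1dep_card.
apply: leq_trans (card_inj_preim (P := fun y => (x, y) \in Z)
  (f := fun y => colour L (leaf v x) (zz x) (leaf b y)) Q _).
  rewrite -[leqRHS](card_imset _ (f := fun y => (x, y))); last by move=> y y' [].
  apply: subset_leq_card; apply/subsetP => -[x' y]; rewrite !inE /=.
  by move=> /andP[/andP[h1 h2] /eqP xx]; subst x'; apply: imset_f; rewrite !inE h1.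
move=> y y' h h'; move/colour_inj => hi.
by apply: (@leaf_inj b); apply: hi; [apply: (bridging_edge hZ h)|apply: (bridging_edge hZ h')].
Qed.

Lemma card_leaf_hits_sym (Q : seq C) (zz : word -> chain) :
  #|[set p in Z | colour L (leaf b p.2) (zz p.2) (leaf v p.1) \in Q]|
  <= #|{: word}| * size Q.
Proof.
rewrite -sum_nat_const -sum1_card (partition_big (fun p => p.2) predT) //=.
apply: leq_sum => y _; rewrite sum1dep_card.
apply: leq_trans (card_inj_preim (P := fun x => (x, y) \in Z)
  (f := fun x => colour L (leaf b y) (zz y) (leaf v x)) Q _).
  rewrite -[leqRHS](card_imset _ (f := fun x => (x, y))); last by move=> x x' [].
  apply: subset_leq_card; apply/subsetP => -[x y']; rewrite !inE /=.
  by move=> /andP[/andP[h1 h2] /eqP yy]; subst y'; apply: imset_f; rewrite !inE h1.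
move=> x x' h h'; move/colour_inj => hi.
apply: (@leaf_inj v); apply: hi; rewrite e_sym;
  [exact: (bridging_edge hZ h)|exact: (bridging_edge hZ h')].
Qed.

(** Replacing each colour by a node that has it turns the colourings given by
    the embedding into colourings of the kind [jointly_spread] quantifies over,
    whose number does not depend on the embedding. *)
Lemma card_clash (z z' : chain) :
  32 * #|[set p in Z |
    has (mem (walk_colours L (root v) z (down a0 v p.1)))
        (walk_colours L (root b) z' (down a0 b p.2))]| <= #|Z|.
Proof.
set D := [set p in Z | _].
have [->|[p0]] := set_0Vmem D; first by rewrite cards0.
rewrite inE => /andP[_ /hasP[q0 _ q0X]].
have [i0 _] := mem_walk_colours_down q0X.
pose nX (t : 'I_R * word) := node_colour a0 L v z t.1 t.2.
pose nY (t : 'I_R * word) := node_colour a0 L b z' t.1 t.2.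
pose rep (q : C) := odflt (i0, p0.1) [pick t | nX t == q].
have repK t : nX (rep (nX t)) = nX t.
  by rewrite /rep; case: pickP => [t' /eqP|/(_ t)] //=; rewrite eqxx.
have spr := bridging_spread hZ (cX := fun t => rep (nX t)) (fun t => rep (nY t)).
apply: leq_trans (spr _); last first.
  move=> i s a c /= h; apply: (node_colour_inj e_tree (L := L) (u := v) (z := z) (i := i) (s := s)).
  by have := congr1 nX h; rewrite !repK.
rewrite leq_mul2l /=; apply: subset_leq_card; apply/subsetP => p.
rewrite !inE => /andP[-> /hasP[q qY qX]] /=.
have [i hi] := mem_walk_colours_down qX; have [j hj] := mem_walk_colours_down qY.
by apply/existsP; exists i; apply/existsP; exists j; rewrite /nX /nY /= -hi -hj.
Qed.

Lemma card_bad_lifts z : 16 * #|[set p in Z | ~~ good p z]| <= #|Z|.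
Proof.
pose Q := forbidden L (root b) (root v) (gamma v) (gamma b) z.
pose zv := (z + edge_chain (root b) (root v))%R.
have sQ : size Q <= 3 + 2 * l.
  rewrite /Q /forbidden /= size_cat !size_walk_colours.
  by have := gamma_size v; have := gamma_size b; clear; lia.
pose D1 := [set p in Z | p.1 \in
  [set x | has (mem Q) (walk_colours L (root v) zv (down a0 v x))]].
pose D2 := [set p in Z | colour L (leaf v p.1)
   (zv + walk_chain (root v) (down a0 v p.1))%R (leaf b p.2) \in Q].
pose D3 := [set p in Z | p.2 \in
  [set x | has (mem Q) (walk_colours L (root b) z (down a0 b x))]].
pose D4 := [set p in Z | colour L (leaf b p.2)
   (z + walk_chain (root b) (down a0 b p.2))%R (leaf v p.1) \in Q].
pose D5 := [set p in Z |
    has (mem (walk_colours L (root v) zv (down a0 v p.1)))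
        (walk_colours L (root b) z (down a0 b p.2))].
have sub : [set p in Z | ~~ good p z] \subset D1 :|: D2 :|: (D3 :|: D4) :|: D5.
  apply/subsetP => p; rewrite !inE => /andP[-> /=].
  rewrite /good /good_lift !negb_and !negbK -/Q -/zv.
  rewrite -!cats1 !walk_colours_cat !has_cat /= !orbF !last_down.
  by rewrite !orbA.
have h1 : #|D1| <= R * (3 + 2 * l) * #|{: word}|.
  apply: leq_trans (cap_count _ (bridging_cap1 hZ)) _.
  apply: leq_trans (card_down_hits e_tree L v zv Q) _.
  by rewrite leq_mul2r leq_mul2l sQ !orbT.
have h3 : #|D3| <= R * (3 + 2 * l) * #|{: word}|.
  apply: leq_trans (cap_count _ (bridging_cap2 hZ)) _.
  apply: leq_trans (card_down_hits e_tree L b z Q) _.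
  by rewrite leq_mul2r leq_mul2l sQ !orbT.
have h2 : #|D2| <= #|{: word}| * (3 + 2 * l).
  apply: leq_trans (card_leaf_hits Q
    (fun x => zv + walk_chain (root v) (down a0 v x))%R) _.
  by rewrite leq_mul2l sQ orbT.
have h4 : #|D4| <= #|{: word}| * (3 + 2 * l).
  apply: leq_trans (card_leaf_hits_sym Q
    (fun x => z + walk_chain (root b) (down a0 b x))%R) _.
  by rewrite leq_mul2l sQ orbT.
have h5 := card_clash zv z; rewrite -/D5 in h5.
have hU : #|[set p in Z | ~~ good p z]| <= #|D1| + #|D2| + (#|D3| + #|D4|) + #|D5|.
  apply: leq_trans (subset_leq_card sub) _.
  apply: leq_trans (leq_of_leqif (leq_card_setU _ _)) _; rewrite leq_add2r.
  apply: leq_trans (leq_of_leqif (leq_card_setU _ _)) _.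
  by apply: leq_add; apply: (leq_of_leqif (leq_card_setU _ _)).
have h6 : #|D1| + #|D2| + (#|D3| + #|D4|) <= 2 * (R.+1 * (3 + 2 * l) * #|{: word}|).
  move: h1 h2 h3 h4; set w := #|{: word}|; set M := 3 + 2 * l.
  by rewrite (mulSn R M) mulnDl (mulnC w M); clear; lia.
move: h5 h6 hU Zbig; clear; lia.
Qed.

Definition hub_hits (u w : U) : {set chain} :=
  [set z : chain | colour L (root u) z (root w) \in walk_colours L (root u) z (gamma u)].

Lemma hub_hits_far :
  [set z : chain | colour L (root b) z (root v) \in
     walk_colours L (root v) (z + edge_chain (root b) (root v))%R (gamma v)]
  = [set z : chain | (z + edge_chain (root b) (root v))%R \in hub_hits v b].
Proof.
apply/setP => z; rewrite !inE (colour_sym L e_sym) //.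
exact: e_core.
Qed.

Lemma card_shift (D : {set chain}) (c : chain) :
  #|[set z : chain | (z + c)%R \in D]| = #|D|.
Proof.
rewrite -[RHS](card_preimset (f := fun z : chain => (z + c)%R)) //.
exact: addIr.
Qed.

(** Averaging over pairs of a chain and a bridge: by translation invariance
    each of the six lifts is bad for at most one pair in sixteen. *)
Lemma sparse_hub_hits_absurd :
  4 * (#|hub_hits b v| + #|hub_hits v b|) <= #|{: chain}| -> False.
Proof.
move=> hh.
pose a p := bridge_chain (root b) (root v) (leaf v p.1) (leaf b p.2)
    (down a0 v p.1) (down a0 b p.2).
pose d := walk_chain (root v) (gamma v).
pose g := walk_chain (root b) (gamma b).
pose N1 := [set z : chain | z \in hub_hits b v].
pose N2 := [set z : chain | (z + edge_chain (root b) (root v))%R \in hub_hits v b].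
pose nb c := \sum_(p in Z) #|[set z : chain | ~~ good p (z + c p)%R]|.
have hnb c : 16 * nb c <= #|Z| * #|{: chain}|.
  have -> : nb c = \sum_(z : chain) #|[set p in Z | ~~ good p z]|.
    rewrite /nb; have -> : \sum_(p in Z) #|[set z : chain | ~~ good p (z + c p)%R]|
       = \sum_(p in Z) \sum_(z : chain) (~~ good p z : nat).
      apply: eq_bigr => p _.
      rewrite -card_sum_nat -[RHS](card_shift _ (c p)).
      by apply: eq_card => z; rewrite !inE.
    rewrite exchange_big /=; apply: eq_bigr => z _.
    rewrite -sum1dep_card [RHS]big_mkcondr /=.
    by apply: eq_bigr => p _; case: (~~ _).
  rewrite big_distrr /= mulnC -sum_nat_const.
  by apply: leq_sum => z _; apply: card_bad_lifts.
pose s0 (p : word * word) : chain := 0%R.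
have Zpos : 0 < #|Z|.
  apply: leq_trans Zbig; rewrite !muln_gt0 /=.
  by apply/card_gt0P; exists [ffun=> a0].
have Cpos : 0 < #|{: chain}| by apply/card_gt0P; exists 0%R.
suff : #|Z| * #|{: chain}| <= #|Z| * (#|N1| + #|N2|) +
   (nb s0 + nb (fun=> d) + nb (fun=> g) + nb a +
    nb (fun p => a p + d)%R + nb (fun p => a p + g)%R).
  have h1 := hnb s0; have h2 := hnb (fun=> d); have h3 := hnb (fun=> g).
  have h4 := hnb a; have h5 := hnb (fun p => a p + d)%R.
  have h6 := hnb (fun p => a p + g)%R.
  have h7 : #|Z| * (4 * (#|N1| + #|N2|)) <= #|Z| * #|{: chain}|.
    rewrite leq_mul2l; apply/orP; right; apply: leq_trans hh.
    have -> : #|N1| = #|hub_hits b v| by apply: eq_card => z; rewrite inE.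
    by rewrite /N2 card_shift.
  have : 0 < #|Z| * #|{: chain}| by rewrite muln_gt0 Zpos Cpos.
  move: h1 h2 h3 h4 h5 h6 h7; rewrite (mulnCA _ 4); clear.
  move: (#|Z| * #|{: chain}|) (#|Z| * (#|N1| + #|N2|)) => x y.
  move: (nb s0) (nb (fun=> d)) (nb (fun=> g)) (nb a) (nb _) (nb _).
  lia.
have hpt p (z : chain) : p \in Z ->
  1 <= ((z \in N1) + (z \in N2)) + (~~ good p (z + s0 p)%R + ~~ good p (z + d)%R
    + ~~ good p (z + g)%R + ~~ good p (z + a p)%R + ~~ good p (z + (a p + d))%R
    + ~~ good p (z + (a p + g))%R).
  move=> pZ.
  case: (boolP (z \in N1)) => // n1; case: (boolP (z \in N2)) => // n2.
  case: (boolP (good p (z + s0 p)%R)) => // g0.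
  case: (boolP (good p (z + d)%R)) => // g1.
  case: (boolP (good p (z + g)%R)) => // g2.
  case: (boolP (good p (z + a p)%R)) => // g3.
  case: (boolP (good p (z + (a p + d))%R)) => // g4.
  case: (boolP (good p (z + (a p + g))%R)) => // g5.
  exfalso; rewrite /s0 addr0 in g0; rewrite addrA in g4; rewrite addrA in g5.
  apply: (good_lifts_absurd e_sym (e_core Kbv) _ (path_down e_tree v p.1)
    (last_down a0 v p.1) (path_down e_tree b p.2) (last_down a0 b p.2) _
    (gamma_path v) (gamma_last v) (gamma_odd v)
    (gamma_path b) (gamma_last b) (gamma_odd b) _ _ g0 g1 g2 g3 g4 g5).
  - by rewrite e_sym; have := bridging_edge hZ pZ; rewrite e_sym.
  - by rewrite !size_down oddD addbb.
  - by rewrite /N2 -hub_hits_far !inE in n2.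
  - by move: n1; rewrite !inE.
apply: leq_trans (_ : \sum_(p in Z) \sum_(z : chain)
  (((z \in N1) + (z \in N2)) + (~~ good p (z + s0 p)%R + ~~ good p (z + d)%R
    + ~~ good p (z + g)%R + ~~ good p (z + a p)%R + ~~ good p (z + (a p + d))%R
    + ~~ good p (z + (a p + g))%R)) <= _).
  rewrite -sum_nat_const; apply: leq_sum => p pZ.
  rewrite -[#|_|]muln1 -sum_nat_const; apply: leq_sum => z _; exact: hpt.
rewrite -sum_nat_const /nb -!big_split /=.
apply: leq_sum => p pZ; rewrite !card_sum_nat -!big_split /=.
by apply: leq_sum => z _; rewrite !inE.
Qed.

End Bridge.

Lemma sum_hub_hits u :
  \sum_(w | K u w) #|hub_hits u w| <= l * #|{: chain}|.
Proof.
have -> : \sum_(w | K u w) #|hub_hits u w| = \sum_(z : chain)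
   #|[set w | K u w && (colour L (root u) z (root w) \in
       walk_colours L (root u) z (gamma u))]|.
  under eq_bigr => w _ do rewrite card_sum_nat.
  rewrite exchange_big /=; apply: eq_bigr => z _.
  rewrite -sum1dep_card [RHS]big_mkcondr /=.
  by apply: eq_bigr => w _; case: (_ \in _).
rewrite mulnC -sum_nat_const; apply: leq_sum => z _.
apply: leq_trans (gamma_size u); rewrite -(size_walk_colours L (root u) z).
apply: card_inj_preim => w w' kw kw' /colour_inj h.
by have := h (e_core kw) (e_core kw') => -[].
Qed.

(** An average core edge is rarely coloured like a step of the odd walks at
    its two ends, as those walks meet few of the many core edges there. *)
Lemma exists_sparse_hub_hits :
  8 * (l * #|U|) < \sum_u #|K u| ->
  exists b v, K b v /\ 4 * (#|hub_hits b v| + #|hub_hits v b|) <= #|{: chain}|.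
Proof.
move=> dense.
case: (boolP [exists b, exists v, K b v &&
    (4 * (#|hub_hits b v| + #|hub_hits v b|) <= #|{: chain}|)]).
  by move=> /existsP[b /existsP[v /andP[k h]]]; exists b, v.
rewrite negb_exists => /forallP none; exfalso.
have none' b v : K b v -> #|{: chain}| <= 4 * (#|hub_hits b v| + #|hub_hits v b|).
  move=> k; have := none b; rewrite negb_exists => /forallP/(_ v).
  by rewrite k /= -ltnNge => /ltnW.
have Cpos : 0 < #|{: chain}| by apply/card_gt0P; exists 0%R.
have h1 : \sum_u \sum_(w | K u w) #|hub_hits u w| <= #|U| * (l * #|{: chain}|).
  by rewrite -sum_nat_const; apply: leq_sum => u _; apply: sum_hub_hits.
have h2 : \sum_u \sum_(w | K u w) #|hub_hits w u| =
          \sum_u \sum_(w | K u w) #|hub_hits u w|.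
  rewrite (exchange_big_dep predT) //=; apply: eq_bigr => u _.
  by apply: eq_bigl => w; rewrite K_sym.
have h3 : (\sum_u #|K u|) * #|{: chain}| <=
   4 * (\sum_u \sum_(w | K u w) #|hub_hits u w| +
        \sum_u \sum_(w | K u w) #|hub_hits w u|).
  rewrite -big_split /= big_distrr big_distrl /=; apply: leq_sum => u _.
  rewrite -big_split /= big_distrr /= -sum_nat_const.
  by apply: leq_sum => w /none'.
move: h3; rewrite h2 => h3.
have : (8 * (l * #|U|)).+1 * #|{: chain}| <= 8 * (l * #|U|) * #|{: chain}|.
  apply: leq_trans (leq_mul dense (leqnn _)) _; apply: leq_trans h3 _.
  apply: leq_trans (_ : 8 * (#|U| * (l * #|{: chain}|)) <= _); last first.
    by rewrite -!mulnA leq_mul2l /= mulnCA.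
  by move: h1; move: (\sum_u _) (#|U| * _) => x y; clear; lia.
by rewrite leq_pmul2r // ltnn.
Qed.
End Layered.

(** The bound on the degrees of [K] lets averaging find a core edge whose colour
    mostly avoids the odd walks at its ends; the bound on [#|Z|] makes the
    bridges that meet a forbidden colour rare. *)
Theorem robust_not_layered :
  8 * (l * #|U|) < \sum_u #|K u| ->
  (forall b v, K b v -> exists2 Z, bridging e b v Z &
     64 * (R.+1 * (3 + 2 * l) * #|{: word}|) <= #|Z|) ->
  ~ layered (homology_cover e_sym e_irr).
Proof.
move=> dense bridges /layered_cover_colouring[C [L]].
have [b [v [Kbv h]]] := exists_sparse_hub_hits L dense.
have [Z hZ Zbig] := bridges b v Kbv.
exact: (sparse_hub_hits_absurd Kbv hZ Zbig h).
Qed.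
End Robust.

(** * Choosing bridges *)

(** Derandomised sampling.  The potential that sums [B ^ number of bad points]
    over [T] at most doubles when the new point is chosen well among those
    admissible, because a uniform admissible point is bad for a given [t] with
    probability at most [1 / B]. *)
Lemma exists_balanced_set (P T : finType) (bad : T -> pred P) (ok : {set P} -> Prop)
    (B m : nat) :
  0 < B -> ok set0 ->
  (forall Z, ok Z -> #|Z| < m -> exists A : {set P}, [/\ 0 < #|A|,
     forall p, p \in A -> p \notin Z /\ ok (p |: Z) &
     forall t, B * #|[set p in A | bad t p]| <= #|A|]) ->
  exists Z, [/\ ok Z, #|Z| = m &
    forall t, B ^ #|[set p in Z | bad t p]| <= #|T| * 2 ^ m].
Proof.
move=> B0 ok0 step.
pose phi (Z : {set P}) := \sum_t B ^ #|[set p in Z | bad t p]|.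
suff H j : j <= m -> exists Z, [/\ ok Z, #|Z| = j & phi Z <= #|T| * 2 ^ j].
  have [Z [h1 h2 h3]] := H m (leqnn m); exists Z; split => // t.
  by apply: leq_trans h3; rewrite /phi (bigD1 t) //= leq_addr.
elim: j => [|j IH] jm.
  exists set0; split; rewrite ?cards0 // muln1 /phi -sum1_card.
  apply: leq_sum => t _; rewrite (_ : [set p in set0 | _] = set0) ?cards0 //.
  by apply/setP => p; rewrite !inE.
have [Z [okZ cZ pZ]] := IH (ltnW jm).
have [|A [A0 hA bA]] := step Z okZ; first by rewrite cZ.
have [p pA hp] : exists2 p, p \in A & phi (p |: Z) <= 2 * phi Z.
  case: (boolP [exists p in A, phi (p |: Z) <= 2 * phi Z]).
    by move=> /existsP[p /andP[pA h]]; exists p.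
  rewrite negb_exists => /forallP none; exfalso.
  have h1 : \sum_(p in A) (2 * phi Z).+1 <= \sum_(p in A) phi (p |: Z).
    by apply: leq_sum => p pA; have := none p; rewrite pA /= -ltnNge.
  have h2 : \sum_(p in A) phi (p |: Z) <= 2 * phi Z * #|A|.
    rewrite /phi exchange_big /= big_distrr big_distrl /=; apply: leq_sum => t _.
    set n := #|[set p in Z | bad t p]|.
    apply: leq_trans (_ : \sum_(p in A) (B ^ n * (1 + B * bad t p)) <= _).
      apply: leq_sum => p pA; have [pZ' _] := hA p pA.
      have : #|[set p' in p |: Z | bad t p']| <= n + bad t p.
        rewrite addnC; apply: leq_trans (_ : #|[set p' in [set p] | bad t p'] :|:
             [set p' in Z | bad t p']| <= _).
          by apply: subset_leq_card; apply/subsetP => p'; rewrite !inE andb_orl.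
        apply: leq_trans (leq_of_leqif (leq_card_setU _ _)) _.
        rewrite leq_add2r; case: (boolP (bad t p)) => hb.
          apply: leq_trans (_ : #|[set p]| <= _); last by rewrite cards1.
          by apply: subset_leq_card; apply/subsetP => p'; rewrite !inE => /andP[].
        rewrite leqn0 cards_eq0; apply/eqP/setP => p'; rewrite !inE.
        by case: eqP => // ->; apply/negbTE.
      move=> hle; apply: leq_trans (leq_pexp2l B0 hle) _.
      rewrite expnD leq_mul2l; apply/orP; right.
      by case: (bad t p); rewrite ?expn1 ?muln1 ?muln0 //= leqW.
    rewrite -big_distrr /= -mulnA mulnCA leq_mul2l; apply/orP; right.
    rewrite big_split /= -big_distrr /= sum1_card mul2n -addnn leq_add2l.
    apply: leq_trans (bA t); rewrite leq_mul2l; apply/orP; right.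
    rewrite -sum1dep_card [leqRHS]big_mkcondr /=.
    by apply: leq_sum => p _; case: (bad t p).
  have := leq_trans h1 h2; rewrite sum_nat_const mulnC leq_pmul2r //.
  by rewrite ltnn.
exists (p |: Z); have [pZ' okp] := hA p pA; split => //.
  by rewrite cardsU1 pZ' cZ.
by rewrite expnS mulnCA; apply: leq_trans hp _; rewrite leq_mul2l pZ orbT.
Qed.

Section AddBridges.
Variables (U : finType) (R : nat) (A : finType) (a0 : A).
Local Notation word := {ffun 'I_R -> A}.
Local Notation V := (tree_vertex U R A).
Local Notation q := #|A|.
Local Notation L := #|{: word}|.
Local Notation T := ('I_R * word)%type.

Section Relation.
Variables (e : rel V) (b v : U).

Definition bridge_rel (Z : {set word * word}) : rel V := fun x y =>
  e x y || [exists p in Z, (x == leaf v p.1) && (y == leaf b p.2)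
                        || (x == leaf b p.2) && (y == leaf v p.1)].

Lemma bridge_rel_sym Z : symmetric e -> symmetric (bridge_rel Z).
Proof.
move=> e_sym x y; rewrite /bridge_rel e_sym; congr (_ || _).
apply: eq_existsb => p; congr (_ && _).
by rewrite orbC; congr (_ || _); rewrite andbC.
Qed.

Lemma bridge_rel_irrefl Z : b != v -> irreflexive e -> irreflexive (bridge_rel Z).
Proof.
move=> bv e_irr x; rewrite /bridge_rel e_irr /=; apply/negbTE/negP.
move=> /existsP[p /andP[_]] /orP[]/andP[/eqP -> /eqP[h _]];
by move: bv; rewrite h eqxx.
Qed.

Lemma bridge_rel_setU1 p Z :
  subrel (bridge_rel (p |: Z))
         (add_edge (bridge_rel Z) (leaf v p.1) (leaf b p.2)).
Proof.
move=> x y; rewrite /bridge_rel /add_edge => /orP[->//|].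
move=> /existsP[p' /andP[]]; rewrite !inE => /orP[/eqP ->|pZ].
  by move=> /orP[] ->; rewrite ?orbT.
move=> h; suff -> : [exists p in Z, (x == leaf v p.1) && (y == leaf b p.2)
                        || (x == leaf b p.2) && (y == leaf v p.1)].
  by rewrite orbT.
by apply/existsP; exists p'; rewrite pZ.
Qed.

Definition capped (Z : {set word * word}) : Prop :=
  (forall x, #|[set p in Z | p.1 == x]| <= q) /\
  (forall y, #|[set p in Z | p.2 == y]| <= q).

Lemma max_degree_bridge D Z : max_degree e D -> capped Z ->
  max_degree (bridge_rel Z) (D + 2 * q).
Proof.
move=> hD [c1 c2] x.
pose N1 := [set leaf b p.2 | p in [set p in Z | p.1 == x.2]] : {set V}.
pose N2 := [set leaf v p.1 | p in [set p in Z | p.2 == x.2]] : {set V}.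
apply: leq_trans (_ : #|[set y | e x y] :|: (N1 :|: N2)| <= _).
  apply: subset_leq_card; apply/subsetP => y.
  rewrite -[y \in _]/(bridge_rel Z x y) 2!in_setU [y \in [set _ | _]]in_set.
  move=> /orP[->//|/existsP[p /andP[pZ]]].
  move=> /orP[]/andP[/eqP xE /eqP ->]; apply/orP; right; apply/orP; [left|right].
    by apply/imsetP; exists p => //; rewrite !inE pZ xE /=.
  by apply/imsetP; exists p => //; rewrite !inE pZ xE /=.
apply: leq_trans (leq_of_leqif (leq_card_setU _ _)) _.
rewrite cardsE; apply: leq_add; first exact: hD.
apply: leq_trans (leq_of_leqif (leq_card_setU _ _)) _.
rewrite mul2n -addnn; apply: leq_add.
  by apply: leq_trans (leq_imset_card _ _) (c1 _).
by apply: leq_trans (leq_imset_card _ _) (c2 _).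
Qed.
End Relation.

Lemma card_saturated (f : word * word -> word) (Z : {set word * word}) :
  q * #|[set x | q <= #|[set p in Z | f p == x]|]| <= #|Z|.
Proof.
rewrite mulnC -sum_nat_const -[leqRHS]sum1_card (partition_big f predT) //=.
rewrite big_mkcond /=; apply: leq_sum => x _; rewrite inE.
case: ifP => // h; apply: leq_trans h _; rewrite sum1dep_card.
by apply: eq_leq; apply: eq_card => p; rewrite !inE.
Qed.

Lemma card_pairs_bound (F : word -> pred word) M :
  (forall y, q * #|[set x | F y x]| <= M * L) ->
  q * #|[set p : word * word | F p.2 p.1]| <= M * L * L.
Proof.
move=> h; rewrite card_sum_nat.
have -> : \sum_(p : word * word) (F p.2 p.1 : nat) =
   \sum_(y : word) #|[set x | F y x]|.
  under [RHS]eq_bigr => y _ do rewrite card_sum_nat.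
  by rewrite exchange_big pair_big.
rewrite big_distrr /= [leqRHS]mulnC -sum_nat_const.
by apply: leq_sum => y _; apply: h.
Qed.

Lemma card_clash_pairs (cX cY : T -> T) : sibling_injective cX ->
  q * #|[set p | clash a0 cX cY p]| <= R * R * (L * L).
Proof.
move=> inj.
pose D (i j : 'I_R) := [set p : word * word |
   cX (i, prefix_word a0 i.+1 p.1) == cY (j, prefix_word a0 j.+1 p.2)].
have hD i j : q * #|D i j| <= L * L.
  rewrite -[L * L]mul1n mulnA.
  apply: (@card_pairs_bound (fun y x =>
    cX (i, prefix_word a0 i.+1 x) == cY (j, prefix_word a0 j.+1 y))) => y.
  apply: (card_resample (i := i)) => s.
  apply: leq_trans (card_inj_preim (P := predT)
   (f := fun a => cX (i, set_letter (prefix_word a0 i.+1 s) i a))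
   [:: cY (j, prefix_word a0 j.+1 y)] _); last by move=> a c _ _; apply: inj.
  apply: subset_leq_card; apply/subsetP => a.
  by rewrite !inE prefix_wordS_set.
apply: leq_trans (_ : q * \sum_(i < R) \sum_(j < R) #|D i j| <= _).
  rewrite leq_mul2l; apply/orP; right.
  apply: leq_trans (_ : #|\bigcup_(i < R) \bigcup_(j < R) D i j| <= _).
    apply: subset_leq_card; apply/subsetP => p; rewrite inE.
    move=> /existsP[i /existsP[j h]]; apply/bigcupP; exists i => //.
    by apply/bigcupP; exists j; rewrite // inE.
  have ub (F : 'I_R -> {set word * word}) :
      #|\bigcup_(i < R) F i| <= \sum_(i < R) #|F i|.
    elim/big_rec2: _ => [|i n E _ h]; first by rewrite cards0.
    by apply: leq_trans (leq_of_leqif (leq_card_setU _ _)) _; rewrite leq_add2l.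
  by apply: leq_trans (ub _) _; apply: leq_sum => i _; apply: ub.
rewrite big_distrr /= -mulnA -[X in X * _]card_ord -sum_nat_const.
apply: leq_sum => i _; rewrite big_distrr /= -[X in X * _]card_ord -sum_nat_const.
by apply: leq_sum => j _; apply: hD.
Qed.

(** At each step at least half of the pairs of leaves are admissible: few
    leaves have reached their cap, and few leaves are near a given one.  A
    random admissible pair therefore clashes with probability at most [2 ^ - c]
    for each pair of colourings.  If there are [n] clashes after [m] steps,
    then [2 ^ (c * n)] is at most [2 ^ m] times the number of pairs of
    colourings, hence at most [2 ^ (4 * m)]; this is why [c] is [128 = 32 * 4].
    As [c] is a variable, [2 ^ c] is never evaluated. *)
Lemma add_bridges (e : rel V) (b v : U) (k D m c : nat) :
  1 < k -> symmetric e -> b != v ->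
  no_short_cycle e k -> max_degree e D ->
  16 * (D + 2 * q).+1 ^ k <= L -> 8 * m <= q * L ->
  c = 128 -> 2 * 2 ^ c * (R * R) <= q ->
  (#|{: T}| ^ #|{: T}|) ^ 2 <= 2 ^ (3 * m) ->
  exists Z : {set word * word},
   [/\ no_short_cycle (bridge_rel e b v Z) k,
       max_degree (bridge_rel e b v Z) (D + 2 * q),
       bridging a0 (bridge_rel e b v Z) b v Z & #|Z| = m].
Proof.
move=> k1 e_sym bv nc hD hball hm hc hq hT.
have S0 : 0 < L by apply/card_gt0P; exists [ffun=> a0].
have q0 : 0 < q by apply/card_gt0P; exists a0.
pose injb (cX : {ffun T -> T}) := [forall i, forall s, injectiveb
   [ffun a => cX (i, set_letter s i a)]].
pose bad (t : {ffun T -> T} * {ffun T -> T}) p := injb t.1 && clash a0 t.1 t.2 p.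
have injP cX : injb cX -> sibling_injective cX.
  move=> /forallP h i s; have /injectiveP h' := forallP (h i) s.
  by move=> a a' haa; apply: h'; rewrite !ffunE.
pose ok Z := no_short_cycle (bridge_rel e b v Z) k /\ capped Z.
have ok0 : ok set0.
  split; last first.
    by split=> x; rewrite (_ : [set p in set0 | _] = set0) ?cards0 //;
       apply/setP => p; rewrite !inE.
  move=> x w pw; apply: nc; apply: sub_path pw => y z.
  by rewrite /bridge_rel => /orP[//|/existsP[p]]; rewrite inE.
have B0 : 0 < 2 ^ c by rewrite expn_gt0.
have [|Z [[ncZ cZ] mZ bZ]] := @exists_balanced_set _ _ bad ok (2 ^ c) m B0 ok0; last first.
  exists Z; split=> //; first exact: max_degree_bridge.
  split; [| by case: cZ | by case: cZ |].
    move=> p pZ; apply/orP; right; apply/existsP; exists p.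
    by rewrite pZ !eqxx.
  move=> cX cY inj; rewrite leqNgt; apply/negP => lt.
  pose t := ([ffun x => cX x], [ffun x => cY x]) : {ffun T -> T} * {ffun T -> T}.
  have := bZ t.
  have -> : #|[set p in Z | bad t p]| = #|[set p in Z | clash a0 cX cY p]|.
    apply: eq_card => p; rewrite !inE; congr (_ && _); rewrite /bad.
    have -> : injb t.1.
      apply/forallP => i; apply/forallP => s; apply/injectiveP => a a'.
      by rewrite !ffunE => /inj.
    rewrite /clash /=; apply: eq_existsb => i; apply: eq_existsb => j.
    by rewrite !ffunE.
  move: lt; set n := #|[set p in Z | clash a0 cX cY p]| => lt; rewrite -expnM hc => h.
  have h2 : 2 ^ (4 * m).+1 <= 2 ^ (4 * m).
    apply: leq_trans (_ : 2 ^ (128 * n) <= _).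
      by rewrite leq_exp2l //; move: lt; rewrite mZ; clear; lia.
    apply: leq_trans h _; rewrite card_prod card_ffun mulnn.
    rewrite (_ : 4 * m = 3 * m + m); last by clear; lia.
    by rewrite expnD leq_mul2r hT orbT.
  by move: h2; rewrite leq_exp2l // ltnn.
move=> Z [ncZ cZ] mZ.
have dZ := max_degree_bridge b v hD cZ.
set e' := bridge_rel e b v Z in ncZ dZ.
have e'_sym : symmetric e' by apply: bridge_rel_sym.
pose X1 := [set x | q <= #|[set p in Z | p.1 == x]|].
pose X2 := [set y | q <= #|[set p in Z | p.2 == y]|].
pose near := [set p : word * word | leaf b p.2 \in ball e' k (leaf v p.1)].
pose W := [set p : word * word | [&& p.1 \notin X1, p.2 \notin X2 & p \notin near]].
have cX1 : 8 * #|X1| <= L.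
  rewrite -(leq_pmul2l q0); apply: leq_trans hm; rewrite mulnCA leq_mul2l /=.
  by apply: leq_trans (card_saturated _ _) (ltnW mZ).
have cX2 : 8 * #|X2| <= L.
  rewrite -(leq_pmul2l q0); apply: leq_trans hm; rewrite mulnCA leq_mul2l /=.
  by apply: leq_trans (card_saturated _ _) (ltnW mZ).
have cnear : 16 * #|near| <= L * L.
  apply: leq_trans (_ : 16 * (L * (D + 2 * q).+1 ^ k) <= _); last first.
    by rewrite mulnCA leq_mul2l hball orbT.
  rewrite leq_mul2l /= card_sum_nat -(pair_big xpredT xpredT
     (fun x y => (leaf b y \in ball e' k (leaf v x) : nat))) /= -sum_nat_const.
  apply: leq_sum => x _; apply: leq_trans (card_ball k (leaf v x) dZ).
  rewrite -card_sum_nat -(card_imset _ (@leaf_inj U R A b)).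
  by apply: subset_leq_card; apply/subsetP => y /imsetP[y']; rewrite inE => h ->.
have cW : L * L <= 2 * #|W|.
  have : L * L <= #|X1| * L + L * #|X2| + #|near| + #|W|.
    rewrite -card_prod -[X in X <= _]cardsT.
    have -> : [set: word * word] = setX X1 setT :|: setX setT X2 :|: near :|: W.
      apply/setP => p; rewrite !inE.
      by case: (_ <= _); case: (_ <= _); case: (_ \in ball _ _ _).
    apply: leq_trans (leq_of_leqif (leq_card_setU _ _)) _; rewrite leq_add2r.
    apply: leq_trans (leq_of_leqif (leq_card_setU _ _)) _; rewrite leq_add2r.
    apply: leq_trans (leq_of_leqif (leq_card_setU _ _)) _.
    by rewrite !cardsX !cardsT.
  have : 8 * (#|X1| * L) <= L * L by rewrite mulnA leq_mul2r cX1 orbT.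
  have : 8 * (L * #|X2|) <= L * L by rewrite mulnCA leq_mul2l cX2 orbT.
  move: cnear; move: (L * L) (#|X1| * L) (L * #|X2|) #|near| #|W|.
  by clear; lia.
exists W; split.
- have SS : 0 < L * L by rewrite muln_gt0 S0.
  by move: cW SS; move: (L * L) #|W| => x y; clear; lia.
- move=> p; rewrite !inE -!ltnNge => /and3P[x1 x2 pn].
  have fr : far e' k (leaf v p.1) (leaf b p.2) by apply: far_outside_ball.
  split.
    apply/negP => pZ; have := fr [:: leaf b p.2]; rewrite /= andbT.
    have -> : e' (leaf v p.1) (leaf b p.2).
      by apply/orP; right; apply/existsP; exists p; rewrite pZ !eqxx.
    by move=> /(_ isT erefl); rewrite leqNgt k1.
  split.
    move=> x w pw; apply: (no_short_cycle_add_edge e'_sym ncZ fr).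
    by apply: sub_path pw; apply: bridge_rel_setU1.
  have cap f : #|[set p' in Z | f p' == f p]| < q ->
      (forall x, #|[set p' in Z | f p' == x]| <= q) ->
      forall x : word, #|[set p' in p |: Z | f p' == x]| <= q.
    move=> lt cf x; have [fx|nfx] := eqVneq (f p) x; last first.
      apply: leq_trans (cf x); apply: subset_leq_card; apply/subsetP => p'.
      by rewrite !inE => /andP[/orP[/eqP ->|->] //]; rewrite (negPf nfx).
    apply: leq_trans (_ : #|p |: [set p' in Z | f p' == f p]| <= _).
      apply: subset_leq_card; apply/subsetP => p'; rewrite !inE fx.
      by case/andP=> /orP[->|->] // ->; rewrite orbT.
    by rewrite cardsU1; apply: leq_trans lt; rewrite -add1n leq_add2r; case: (_ \notin _).
  by case: cZ => c1 c2; split; apply: cap.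
- move=> [cX cY]; case: (boolP (injb cX)) => hi; last first.
    rewrite (_ : [set p in W | _] = set0) ?cards0 ?muln0 //.
    by apply/setP => p; rewrite !inE /bad /= (negPf hi) !andbF.
  have := card_clash_pairs cY (injP _ hi); set n := #|_| => hn.
  apply: leq_trans (_ : 2 ^ c * n <= _).
    rewrite leq_mul2l; apply/orP; right; apply: subset_leq_card.
    by apply/subsetP => p; rewrite !inE => /andP[_ /andP[]].
  rewrite -(@leq_pmul2l 2) //; apply: leq_trans cW.
  rewrite -(leq_pmul2l q0).
  have -> : q * (2 * (2 ^ c * n)) = 2 * 2 ^ c * (q * n).
    by rewrite mulnCA -mulnA; congr (_ * _); rewrite mulnCA.
  apply: leq_trans (_ : 2 * 2 ^ c * (R * R * (L * L)) <= _).
    by rewrite leq_mul2l hn orbT.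
  by rewrite mulnA leq_mul2r hq orbT.
Qed.
End AddBridges.

(** * Dense cores of large girth *)

Section Core.
Variable V : finType.

(** Greedy construction: as long as few edges are present, at least half of
    the vertices can still receive an edge, and not all of these are near. *)
Lemma exists_dense_core k c : 1 < k -> 0 < c ->
  2 * ((2 * c).+1 ^ k).+1 <= #|V| ->
  exists e : rel V, [/\ symmetric e, irreflexive e, no_short_cycle e k &
    c * #|V| <= \sum_u #|e u|].
Proof.
move=> k1 c0 hV.
suff H j : j <= c * #|V| -> exists e : rel V,
   [/\ symmetric e, irreflexive e, no_short_cycle e k, max_degree e (2 * c) &
    j <= \sum_u #|e u|].
  by have [e [h1 h2 h3 _ h5]] := H _ (leqnn _); exists e.
elim: j => [|j IH] jm.
  exists (fun _ _ => false); split => //; first by move=> x [|y w].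
  by move=> x; rewrite (eq_card0 (A := fun _ : V => false)).
have [e [e_sym e_irr nc hd hj]] := IH (ltnW jm).
have [done|lt] := ltnP j (\sum_u #|e u|); first by exists e.
have {hj lt} hj : \sum_u #|e u| = j by apply/eqP; rewrite eqn_leq lt hj.
pose sat := [set u | 2 * c <= #|e u|].
have csat : 2 * #|sat| <= #|V|.
  rewrite -(leq_pmul2l c0) mulnCA mulnA mulnC -sum_nat_const.
  apply: leq_trans (ltnW jm); rewrite -hj big_mkcond /=.
  by apply: leq_sum => u _; rewrite inE; case: ifP.
have cfree : (2 * c).+1 ^ k < #|~: sat|.
  have := cardsC sat; move: csat hV; clear.
  by move: #|sat| #|~: sat| #|V| ((2 * c).+1 ^ k) => x y z t; lia.
have [a ha] : exists a, a \in ~: sat.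
  by apply/card_gt0P; apply: leq_ltn_trans cfree.
have [b hb nb] : exists2 b, b \in ~: sat & b \notin ball e k a.
  apply/exists_inP; rewrite -negb_forall_in; apply/negP => /forall_inP h.
  have /subset_leq_card : ~: sat \subset ball e k a by apply/subsetP.
  by rewrite leqNgt (leq_ltn_trans (card_ball k a hd) cfree).
have fr := far_outside_ball nb.
have ab : a != b by apply: far_neq fr; apply: ltnW.
exists (add_edge e a b); split.
- exact: add_edge_sym.
- exact: add_edge_irrefl.
- exact: no_short_cycle_add_edge.
- move=> x; apply: leq_trans (card_add_edge e a b x) _.
  rewrite !inE -!ltnNge in ha hb.
  have [->|xa] := eqVneq x a; first by rewrite (negPf ab) addn0 addn1.
  by have [->|xb] := eqVneq x b; rewrite /= ?addn1 // !addn0; apply: hd.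
- rewrite -hj (bigD1 a) //= [X in _ <= X](bigD1 a) //= -addSn; apply: leq_add.
    have eab : ~~ e a b.
      apply/negP => h; have := fr [:: b]; rewrite /= h => /(_ isT erefl).
      by rewrite leqNgt k1.
    apply: leq_trans (_ : #|[predU1 b & e a]| <= _).
      by rewrite cardU1 -[b \in _]/(e a b) eab.
    apply: subset_leq_card; apply/subsetP => y; rewrite inE.
    rewrite -[y \in add_edge _ _ _ _]/(add_edge e a b a y) -[y \in e a]/(e a y).
    by rewrite /add_edge eqxx /= => /orP[->|->]; rewrite ?orbT.
  apply: leq_sum => u _; apply: subset_leq_card; apply/subsetP => y.
  rewrite -[y \in add_edge _ _ _ _]/(add_edge e a b u y) -[y \in e u]/(e u y).
  by rewrite /add_edge => ->.
Qed.

End Core.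

(** * Attaching trees, odd walks and bridges to the core *)

Section Pendant.
(** Every edge lies in the core, at height [0], or joins a vertex to its parent
    one level below. *)
Variables (V : finType) (e : rel V) (h : V -> nat) (p : V -> V) (k : nat).
Hypothesis e_step : forall x y, e x y ->
  [\/ h x = 0 /\ h y = 0, h y = (h x).+1 /\ x = p y | h x = (h y).+1 /\ y = p x].
Hypothesis core_girth : forall x w, path e x w -> reduced x w -> last x w = x ->
  w != [::] -> h x = 0 -> all (fun y => h y == 0) w -> k <= size w.

Lemma reduced_up x y w : path e x (y :: w) -> reduced x (y :: w) ->
  h y = (h x).+1 -> h x < h (last y w).
Proof.
elim: w x y => [|z w IH] x y /=; first by move=> _ _ ->.
move=> /and3P[exy eyz pw] /andP[zx /andP[r1 r2]] hy.
have hz : h z = (h y).+1.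
  case: (e_step exy) (e_step eyz) => [[_ h0]|[_ xE]|[h0 _]]; try by move: hy h0; lia.
  case=> [[h0 _]|[//]|[_ zE]]; first by move: hy h0; lia.
  by move: zx; rewrite zE xE eqxx.
apply: leq_trans (_ : h y < _); first by rewrite hy.
by apply: IH => //=; rewrite ?eyz ?r1.
Qed.

(** A reduced walk that ends higher than it starts ends with a step from a
    parent to its child, because after such a step it cannot turn back. *)
Lemma reduced_last_up x w : path e x w -> reduced x w ->
  h (last x w) <= h x \/
  exists w' z, [/\ w = rcons w' z, last x w' = p z & h z = (h (last x w')).+1].
Proof.
elim/last_ind: w => [|w z IH]; first by left.
rewrite rcons_path last_rcons -cats1 => /andP[pw ez] rw.
have /andP[rw1 _] := reduced_cat rw.
case: (e_step ez) => [[_ ->]|[hz uz]|[hu zu]]; first by left.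
  by right; exists w, z; rewrite cats1.
case: (IH pw rw1) => [hl|[w' [u [wE lw hu']]]].
  by left; apply: leq_trans hl; rewrite hu.
move: rw zu hu; rewrite wE last_rcons => rw zu _.
rewrite -cats1 -catA in rw; have /andP[_] := reduced_cat rw.
by rewrite /= zu lw eqxx.
Qed.

(** A reduced walk that steps away from the core never turns back, so that a
    closed one is carried by the core up to its initial and final segments. *)
Lemma no_short_cycle_pendant : no_short_cycle e k.
Proof.
move=> x w; have [n] := ubnP (size w); elim: n x w => // n IH x w sw pw rw lw wn.
have [hx|hx] := posnP (h x).
  apply: (core_girth pw rw lw wn hx); apply/allP => z zw; apply/eqP.
  have [//|hz] := posnP (h z); exfalso.
  case/splitPr: zw pw rw lw {wn sw} => w1 w2.
  rewrite -cat_rcons cat_path => /andP[p1 p2] rw lw.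
  have /andP[r1 _] := reduced_cat rw.
  case: (reduced_last_up p1 r1); first by rewrite last_rcons hx leqn0 => /eqP; lia.
  move=> [w' [z' [/eqP]]]; rewrite eqseq_rcons => /andP[/eqP <- /eqP <-] _ hz'.
  move: p1 p2; rewrite rcons_path last_rcons => /andP[p1 ez] p2.
  rewrite cat_rcons in rw lw; have /andP[_ r2] := reduced_cat rw.
  have := reduced_up (x := last x w1) (y := z) (w := w2).
  rewrite /= ez p2 => /(_ isT r2 hz'); rewrite last_cat /= in lw.
  by rewrite lw hx.
case: w sw pw rw lw wn => // y w sw pw rw lw _.
have pw' := pw; move: pw' => /= /andP[exy pyw].
have rw' := rw; move: rw' => /= /andP[_ ryw].
case: (e_step exy) => [[h0 _]|[hy _]|[hxy yE]]; first by rewrite h0 in hx.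
  by have := reduced_up pw rw hy; move: lw => /= ->; rewrite ltnn.
case: (reduced_last_up pyw ryw); first by move: lw => /= ->; rewrite hxy ltnn.
move=> [w' [z [wE lw' _]]].
have zx : z = x by move: lw; rewrite /= wE last_rcons.
subst z; rewrite wE in pyw ryw sw rw *.
move: pyw; rewrite rcons_path => /andP[pw1 _].
rewrite -cats1 in ryw; have /andP[rw1 _] := reduced_cat ryw.
have w'n : w' != [::].
  by apply/eqP => w'0; move: rw; rewrite w'0 /= eqxx.
move: sw => /=; rewrite size_rcons => sw.
have sw' : size w' < n by move: sw; clear; lia.
have cw' : last y w' = y by rewrite lw' -yE.
by apply: leq_trans (IH y w' sw' pw1 rw1 cw' w'n) _; rewrite -addn2 leq_addr.
Qed.
End Pendant.

Section Forest.
Variables (U : finType) (R : nat) (A : finType) (a0 : A).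
Local Notation word := {ffun 'I_R -> A}.
Local Notation V := (tree_vertex U R A).
Local Notation root := (@tree_root U R A a0).
Variables (K : rel U) (K_sym : symmetric K) (K_irr : irreflexive K).

Definition parent_rel : rel V := fun x y =>
  [exists i : 'I_R, (x == node y.1.1 i (set_letter y.2 i a0)) &&
                    (y == node y.1.1 i.+1 y.2)].

Definition core_rel : rel V := fun x y =>
  [&& K x.1.1 y.1.1, x == root x.1.1 & y == root y.1.1].

Definition forest_rel : rel V := fun x y =>
  [|| core_rel x y, parent_rel x y | parent_rel y x].

Lemma forest_rel_sym : symmetric forest_rel.
Proof.
move=> x y; rewrite /forest_rel [parent_rel x y || _]orbC; congr (_ || _).
by rewrite /core_rel K_sym; congr (_ && _); rewrite andbC.
Qed.

Definition depth (x : V) : nat := x.1.2.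

Lemma depth_node u i s : i <= R -> depth (node u i s) = i.
Proof. by move=> iR; rewrite /depth /node /= inordK. Qed.

Definition parent (y : V) : V :=
  if (insub (depth y).-1 : option 'I_R) is Some i then node y.1.1 i (set_letter y.2 i a0) else y.

Lemma parent_relP x y :
  parent_rel x y -> depth y = (depth x).+1 /\ x = parent y.
Proof.
move=> /existsP[i /andP[/eqP xE /eqP yE]].
have dx : depth x = i by rewrite xE depth_node // ltnW.
have dy : depth y = i.+1 by rewrite yE depth_node.
by split; rewrite ?dx // /parent dy /= valK.
Qed.

Lemma forest_relP x y : forest_rel x y ->
  [\/ depth x = 0 /\ depth y = 0, depth y = (depth x).+1 /\ x = parent y
    | depth x = (depth y).+1 /\ y = parent x].
Proof.
move=> /or3P[/and3P[_ /eqP -> /eqP ->]|/parent_relP h|/parent_relP h].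
- by apply: Or31; rewrite !depth_node.
- exact: Or32.
- exact: Or33.
Qed.

Lemma forest_rel_irrefl : irreflexive forest_rel.
Proof.
move=> x; apply/negbTE/negP => /or3P[/and3P[]|/parent_relP[h _]|/parent_relP[h _]].
- by rewrite K_irr.
- by move: h; clear; lia.
- by move: h; clear; lia.
Qed.

Lemma forest_tree u (i : 'I_R) s :
  forest_rel (node u i (set_letter s i a0)) (node u i.+1 s).
Proof.
by apply/or3P; apply: Or32; apply/existsP; exists i; rewrite /= !eqxx.
Qed.

Lemma forest_core u w : K u w -> forest_rel (root u) (root w).
Proof. by move=> h; apply/or3P; apply: Or31; rewrite /core_rel /= h !eqxx. Qed.

Lemma forest_core_step x y : forest_rel x y -> depth x = 0 -> depth y = 0 ->
  [/\ K x.1.1 y.1.1, x = root x.1.1 & y = root y.1.1].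
Proof.
move=> /or3P[/and3P[? /eqP ? /eqP ?]|/parent_relP[h _]|/parent_relP[h _]] hx hy //.
  by rewrite hx hy in h.
by rewrite hx hy in h.
Qed.

Lemma no_short_cycle_forest k : no_short_cycle K k -> no_short_cycle forest_rel k.
Proof.
move=> nc; apply: (no_short_cycle_pendant forest_relP) => x w pw rw lw wn hx hw.
rewrite -(size_map (fun y : V => y.1.1)); apply: (nc x.1.1).
- elim: w x pw hx hw {rw lw wn} => //= y w IH x /andP[exy pw] hx /andP[/eqP hy hw].
  by have [-> _ _] := forest_core_step exy hx hy; rewrite (IH y).
- elim: w x pw hx hw rw {lw wn} => //= y w IH x /andP[exy pw] hx /andP[/eqP hy hw].
  move=> /andP[r1 r2]; rewrite (IH y) // andbT.
  case: w pw r1 hw {IH r2} => //= z w /andP[eyz _] zx /andP[/eqP hz _].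
  have [_ xE _] := forest_core_step exy hx hy.
  have [_ _ zE] := forest_core_step eyz hy hz.
  by apply: contra zx => /eqP h; rewrite xE zE h.
- by rewrite (last_map (fun y : V => y.1.1) w x) lw.
- by case: w wn {pw rw lw hw}.
Qed.

Lemma max_degree_forest : max_degree forest_rel (#|U| + 1 + #|A|).
Proof.
move=> x.
pose N1 := [set root w | w : U] : {set V}.
pose child a : V := if (insub (depth x) : option 'I_R) is Some i
  then node x.1.1 i.+1 (set_letter x.2 i a) else x.
pose N3 := [set child a | a : A] : {set V}.
apply: leq_trans (_ : #|N1 :|: [set parent x] :|: N3| <= _).
  apply: subset_leq_card; apply/subsetP => y; rewrite -[y \in _]/(forest_rel x y).
  rewrite 2!in_setU => /or3P[/and3P[_ _ /eqP ->]|h|/parent_relP[_ ->]].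
  - by rewrite imset_f.
  - apply/orP; right; case/existsP: h => i /andP[/eqP xE /eqP yE].
    apply/imsetP; exists (y.2 i) => //.
    have dx : depth x = i by rewrite xE depth_node // ltnW.
    rewrite /child dx valK yE xE /= set_letter_set; congr (node _ _ _).
    by apply/ffunP => j; rewrite !ffunE; case: eqP => // ->.
  - by rewrite inE eqxx orbT.
apply: leq_trans (leq_of_leqif (leq_card_setU _ _)) _; apply: leq_add.
  apply: leq_trans (leq_of_leqif (leq_card_setU _ _)) _; rewrite cards1 leq_add2r.
  by apply: leq_trans (leq_imset_card _ _) _; rewrite ?cardsT.
by apply: leq_trans (leq_imset_card _ _) _; rewrite ?cardsT.
Qed.

Definition tree_edges (e : rel V) : Prop := forall u (i : 'I_R) s,
  e (node u i (set_letter s i a0)) (node u i.+1 s).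

Definition odd_loop (e : rel V) (u : U) (w : seq V) : Prop :=
  [/\ path e (root u) w, last (root u) w = root u, odd (size w) &
      size w <= R.*2.+1].

(** Two far leaves of a tree are joined by an edge; as all leaves have the same
    depth, this edge closes an odd walk through the root. *)
Lemma add_odd_loop (e : rel V) (u : U) k D :
  0 < k -> symmetric e -> irreflexive e -> tree_edges e -> no_short_cycle e k ->
  max_degree e D -> D.+1 ^ k < #|{: word}| ->
  exists e' : rel V, [/\ subrel e e', symmetric e' /\ irreflexive e',
    no_short_cycle e' k, max_degree e' D.+2 & exists w, odd_loop e' u w].
Proof.
move=> k0 e_sym e_irr et nc hd hb.
pose x0 : word := [ffun=> a0].
have [x1 hx1] : exists x1 : word, leaf u x1 \notin ball e k (leaf u x0).
  apply/existsP; rewrite -negb_forall; apply/negP => /forallP h.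
  have : #|{: word}| <= #|ball e k (leaf u x0)|.
    rewrite -cardsT -(card_imset _ (@leaf_inj U R A u)).
    by apply: subset_leq_card; apply/subsetP => y /imsetP[y' _ ->].
  by rewrite leqNgt (leq_ltn_trans (card_ball k (leaf u x0) hd) hb).
have fr := far_outside_ball hx1.
have ne := far_neq k0 fr.
set e' := add_edge e (leaf u x0) (leaf u x1).
have sub : subrel e e' by move=> x y; rewrite /e' /add_edge => ->.
have e'_sym : symmetric e' by apply: add_edge_sym.
exists e'; split => //.
- by split=> //; apply: add_edge_irrefl.
- exact: no_short_cycle_add_edge.
- exact: max_degree_add_edge.
exists (down a0 u x0 ++ leaf u x1 :: rev (belast (root u) (down a0 u x1))).
have p0 := sub_path sub (path_down et u x0).
have p1 := sub_path sub (path_down et u x1).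
split.
- rewrite cat_path p0 last_down /=; apply/andP; split.
    by rewrite /e' /add_edge !eqxx orbT.
  rewrite -(last_down a0 u x1) rev_path; apply: sub_path p1 => x y.
  by rewrite e'_sym.
- rewrite last_cat /=; have := size_down a0 u x1.
  case: (down a0 u x1) (last_down a0 u x1) => [|y w] //=.
  by rewrite rev_cons last_rcons.
- by rewrite size_cat /= size_rev size_belast !size_down addnS /= addnn odd_double.
- by rewrite size_cat /= size_rev size_belast !size_down addnS addnn.
Qed.

Lemma odd_loop_sub (e e' : rel V) u w :
  subrel e e' -> odd_loop e u w -> odd_loop e' u w.
Proof. by move=> s [p l o z]; split => //; apply: sub_path p. Qed.

Lemma add_odd_loops (e : rel V) (us : seq U) k D :
  0 < k -> symmetric e -> irreflexive e -> tree_edges e -> no_short_cycle e k ->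
  max_degree e D -> (D + (size us).*2).+1 ^ k < #|{: word}| ->
  exists e' : rel V, [/\ subrel e e', symmetric e' /\ irreflexive e',
    no_short_cycle e' k, max_degree e' (D + (size us).*2) &
    forall u, u \in us -> exists w, odd_loop e' u w].
Proof.
move=> k0; elim: us e D => [|u us IH] e D e_sym e_irr et nc hd hb.
  by exists e; split; rewrite ?addn0.
have [|e1 [s1 [e1_sym e1_irr] nc1 hd1 [w hw]]] :=
    add_odd_loop u k0 e_sym e_irr et nc hd.
  apply: leq_ltn_trans hb; rewrite leq_exp2r //= ltnS; exact: leq_addr.
have E : D.+2 + (size us).*2 = D + (size (u :: us)).*2.
  by rewrite /= doubleS !addnS !addSn.
have et1 : tree_edges e1 by move=> u' i s; apply: s1; apply: et.
have hb1 : (D.+2 + (size us).*2).+1 ^ k < #|{: word}| by rewrite E.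
have [e2 [s2 [e2_sym e2_irr] nc2 hd2 h2]] :=
  IH e1 D.+2 e1_sym e1_irr et1 nc1 hd1 hb1.
exists e2; split => //.
- by move=> x y /s1/s2.
- by move: hd2; rewrite E.
move=> u'; rewrite inE => /orP[/eqP ->|/h2 //].
by exists w; apply: odd_loop_sub hw.
Qed.

Lemma bridging_sub (e e' : rel V) b v Z :
  subrel e e' -> bridging a0 e b v Z -> bridging a0 e' b v Z.
Proof. by move=> s [h1 h2 h3 h4]; split => // p /h1/s. Qed.

Lemma add_all_bridges (e : rel V) (ps : seq (U * U)) k D m c :
  1 < k -> symmetric e -> irreflexive e -> no_short_cycle e k -> max_degree e D ->
  (forall p, p \in ps -> p.1 != p.2) ->
  16 * (D + (size ps).+1 * (2 * #|A|)).+1 ^ k <= #|{: word}| ->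
  8 * m <= #|A| * #|{: word}| ->
  c = 128 -> 2 * 2 ^ c * (R * R) <= #|A| ->
  (#|{: 'I_R * word}| ^ #|{: 'I_R * word}|) ^ 2 <= 2 ^ (3 * m) ->
  exists e' : rel V, [/\ subrel e e', symmetric e' /\ irreflexive e',
    no_short_cycle e' k &
    forall p, p \in ps -> exists2 Z, bridging a0 e' p.1 p.2 Z & #|Z| = m].
Proof.
move=> k1 + + + + + + hm hc hq hT.
elim: ps e D => [|p ps IH] e D e_sym e_irr nc hd hps hb; first by exists e; split.
have ne : p.1 != p.2 by apply: hps; rewrite inE eqxx.
have [|Z [nc1 hd1 br mZ]] := add_bridges a0 k1 e_sym ne nc hd _ hm hc hq hT.
  apply: leq_trans hb; rewrite leq_mul2l /= leq_exp2r ?(ltnW k1) //.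
  by rewrite ltnS leq_add2l leq_pmull.
set e1 := bridge_rel e p.1 p.2 Z in nc1 hd1 br.
have e1_sym : symmetric e1 by apply: bridge_rel_sym.
have e1_irr : irreflexive e1 by apply: bridge_rel_irrefl.
have [||e2 [s2 [e2_sym e2_irr] nc2 h2]] :=
  IH e1 (D + 2 * #|A|) e1_sym e1_irr nc1 hd1.
- by move=> p' hp'; apply: hps; rewrite inE hp' orbT.
- by rewrite -addnA -mulSn.
exists e2; split => //.
  by move=> x y h; apply: s2; apply/orP; left.
move=> p'; rewrite inE => /orP[/eqP ->|/h2 //].
by exists Z => //; apply: bridging_sub br.
Qed.
End Forest.

(** * Choice of the parameters *)

Lemma linear_le_exp2 C : exists a, C * (a + 4) <= 2 ^ a.
Proof.
exists (C + 4).*2; rewrite -addnn expnD.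
apply: leq_mul; first by apply: leq_trans (ltnW (ltn_expl _ (isT : 1 < 2))); rewrite leq_addr.
elim: C => // C IH; rewrite addSn expnS.
apply: leq_trans (_ : (C + 4 + (C + 4) + 4) + 2 <= _); first by lia.
rewrite mul2n -addnn; apply: leq_add IH _.
by apply: leq_trans (_ : 2 ^ 1 <= _) => //; rewrite leq_exp2l // addn4.
Qed.

(** The order of the choices matters: the depth [R] depends on the girth only,
    the core on [R] through the length [l] of the odd walks, and the number [q]
    of children, a power of two, is large compared with all of these. *)
Theorem theorem1p2 (k : nat) (hk : 0 < k) :
  exists G : sgraph,
    [/\ girth_at_least G k,
        exists n : nat, induced_embeds G (hypercube n)
      & ~ layered G].
Proof.
pose k' := k.+1.
have k1 : 1 < k' by [].
have [R RE] : exists R, R = (2 * k').+1 by exists (2 * k').+1.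
have [l lE] : exists l, l = R.*2.+1 by exists R.*2.+1.
pose d := 8 * l + 1.
have [N NE] : exists N, N = 2 * ((2 * d).+1 ^ k').+1 by eexists.
have d0 : 0 < d by rewrite /d addn1.
have N0 : 0 < N by rewrite NE.
have [|K [K_sym K_irr ncK dK]] := @exists_dense_core 'I_N k' d k1 d0.
  by rewrite card_ord NE.
have [c hc] : exists c, c = 128 by exists 128.
pose C1 := 64 * (R.+1 * (3 + 2 * l)); pose C2 := 2 * 2 ^ c * (R * R).
pose C3 := 16 + 10 * (N * N); pose C4 := 2 * (R * R).
have [a ha] := linear_le_exp2 (C1 + C2 + C3 + C4).
have [hC1 hC2 hC3 hC4] : [/\ C1 <= 2 ^ a, C2 <= 2 ^ a, C3 <= 2 ^ a &
    C4 * (a + 4) <= 2 ^ a].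
  have h : C1 + C2 + C3 + C4 <= 2 ^ a by apply: leq_trans ha; rewrite leq_pmulr ?addnS.
  split; try (apply: leq_trans h; clear; lia).
  by apply: leq_trans ha; rewrite leq_mul2r leq_addl orbT.
pose A : finType := {ffun 'I_(a + 3) -> bool}.
pose a0 : A := [ffun=> false].
pose q := #|A|.
have qE : q = 2 ^ a * 8 by rewrite /q card_ffun card_bool card_ord expnD.
have q3 : C3 <= q by apply: leq_trans hC3 _; rewrite qE leq_pmulr.
pose word : finType := {ffun 'I_R -> A}.
pose W := #|{: word}|.
have WE : W = q ^ R by rewrite /W card_ffun card_ord.
have NN : N <= N * N by rewrite leq_pmull.
(* Degrees stay below [q ^ 2], so balls of radius [k'] are small compared with
   the [q ^ R] leaves. *)
have ball_small D : D <= q * (2 * (N * N) + 4) -> 16 * D ^ k' <= W.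
  move=> hD; rewrite WE RE expnS leq_mul //.
    by apply: leq_trans q3; rewrite /C3 leq_addr.
  rewrite expnM leq_exp2r //; apply: leq_trans hD _; rewrite -mulnn leq_mul2l.
  by apply/orP; right; apply: leq_trans q3; rewrite /C3; clear; lia.
pose D := N + 1 + q.
have hD : max_degree (@forest_rel _ R A a0 K) D.
  by have := @max_degree_forest _ R A a0 K; rewrite card_ord.
have q1 : 3 * N + 2 <= q by apply: leq_trans q3; rewrite /C3; move: NN; clear; lia.
have f_sym := @forest_rel_sym _ R A a0 K K_sym.
have f_irr := @forest_rel_irrefl _ R A a0 K K_irr.
have f_tree := @forest_tree _ R A a0 K.
have f_nc := @no_short_cycle_forest _ R A a0 K k' ncK.
have hbl : (D + (size (enum 'I_N)).*2).+1 ^ k' < W.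
  apply: leq_trans (ball_small (D + (size (enum 'I_N)).*2).+1 _).
    by rewrite -[X in X < _]mul1n ltn_pmul2r // expn_gt0.
  by rewrite size_enum_ord /D; move: q1; clear; nia.
have [e1 [s1 [e1_sym e1_irr] nc1 hd1 loops]] :=
  add_odd_loops (ltnW k1) f_sym f_irr f_tree f_nc hD hbl.
pose ps := [seq p <- enum {: 'I_N * 'I_N} | K p.1 p.2].
have sps : size ps <= N * N.
  apply: leq_trans (_ : size (enum {: 'I_N * 'I_N}) <= _).
    by rewrite size_filter count_size.
  by rewrite -cardE card_prod card_ord.
pose m := 2 ^ a * W.
have [||||||e [s2 [e_sym e_irr] nc bridges]] :=
  @add_all_bridges _ R A a0 e1 ps k' (D + (size (enum 'I_N)).*2) m c k1
     e1_sym e1_irr nc1 hd1.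
- move=> p; rewrite mem_filter => /andP[kp _]; apply/eqP => h.
  by move: kp; rewrite h K_irr.
- apply: ball_small; rewrite size_enum_ord -/q /D; move: q1 sps.
  move: (size ps) (N * N) => x y; clear; nia.
- by rewrite -/q qE -mulnA mulnCA mulnA; apply: eq_leq; rewrite mulnAC.
- exact: hc.
- by apply: leq_trans hC2 _; rewrite -/q qE leq_pmulr.
(* There are about [W ^ (2 * R * W)] pairs of colourings, against [2 ^ (3 * m)]
   with [m] of the order of [q * W]. *)
- rewrite card_prod card_ord -/W -expnM.
  have R0 : 0 < R by rewrite RE.
  have W0 : 0 < W by rewrite WE expn_gt0 qE muln_gt0 expn_gt0.
  have RW : R * W <= 2 ^ (R * (a + 4)).
    have -> : R * (a + 4) = R + (a + 3) * R by clear; lia.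
    rewrite expnD leq_mul //; first by apply: ltnW; apply: ltn_expl.
    by rewrite WE qE (_ : 8 = 2 ^ 3) // -expnD -expnM.
  apply: leq_trans (_ : (2 ^ (R * (a + 4))) ^ (R * W * 2) <= _).
    by rewrite leq_exp2r // !muln_gt0 R0 W0.
  rewrite -expnM leq_exp2l // /m.
  have -> : R * (a + 4) * (R * W * 2) = (C4 * (a + 4)) * W by rewrite /C4; clear; lia.
  by rewrite mulnA leq_mul2r (leq_trans hC4) ?orbT // leq_pmull.
have s12 : subrel (@forest_rel _ R A a0 K) e by move=> x y /s1/s2.
have [gamma hg] := fin_all_exists (fun u => loops u (mem_enum _ u)).
have hg' u := odd_loop_sub s2 (hg u).
exists (homology_cover e_sym e_irr); split.
- have := cover_girth e_sym e_irr nc; rewrite /girth_at_least.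
  by case: (girth _) => // g; apply: leq_trans.
- by eexists; apply: cover_induced.
apply: (@robust_not_layered _ R A a0 e e_sym e_irr _ K K_sym _ l gamma).
- by move=> u i s; apply: s12; apply: forest_tree.
- by move=> u w /(@forest_core _ R A a0 K _ _)/s12.
- by move=> u; have [] := hg' u.
- by move=> u; have [] := hg' u.
- by move=> u; have [] := hg' u.
- by move=> u; rewrite lE; have [] := hg' u.
- apply: leq_trans dK; rewrite card_ord /d mulnDl mul1n mulnA -[X in X < _]addn0.
  by rewrite ltn_add2l.
move=> b v kbv; have [|Z hZ mZ] := bridges (b, v).
  by rewrite mem_filter kbv mem_enum.
exists Z => //; rewrite mZ /m mulnA; apply: leq_mul => //.
Qed.
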